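(* Let $\rho_0=\mathcal{GW}(\{q_k\})$ be a critical Galton-Watson measure on $\mathcal{T}^|$ with $q_1=0$. Assume that one of the following two conditions holds: (a) $\sum_{k=2}^\infty k^2q_k<\infty$; (b) the limit $S'(1)=\lim_{x\to1-}\frac{1-S(x)}{1-x}$ exists, and $\sum_{k=2}^\infty k^{2-\epsilon}q_k<\infty$ for all $\epsilon>0$. Starting with $k=0$, and for each consecutive integer $k$, let $\nu_k=\mathcal{R}_*(\rho_k)$, i.e. $\nu_k(T)=\rho_k(\mathcal{R}^{-1}(T))$, and set $\rho_{k+1}(T)=\nu_k(T\mid T\neq\phi)$. Then for every $T\in\mathcal{T}^|$, $$\lim_{k\to\infty}\rho_k(T)=\rho^*(T),$$ where $\rho^*$ is the critical binary Galton-Watson measure $\mathcal{IGW}(1/2)$, i.e. $\mathcal{GW}(q_0=q_2=1/2)$.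
   Context: Trees. $\mathcal{T}^|$ denotes the set of finite unlabeled rooted trees that are planted (either the empty tree $\phi$ consisting of the root only, or the root has exactly one offspring) and reduced (no vertex of degree $2$; the degree of a non-root vertex is its number of offspring plus one). Galton-Watson measures. For a probability distribution $\{q_k\}_{k\ge 0}$ with $q_1=0$, $\mathcal{GW}(\{q_k\})$ is the law of the random tree whose root has a single offspring and in which every non-root vertex independently has $k$ offspring with probability $q_k$. It is critical if $\sum_k kq_k=1$; it is then a probability measure on $\mathcal{T}^|$ giving mass zero to $\phi$. Let $Q(z)=\sum_{m\ge 0}q_mz^m$ and $S(z)=\frac{Q(z)-zQ'(z)}{1-Q'(z)}$ for $z\in[0,1)$. Horton pruning. $\mathcal{R}(T)$ for $T\neq\phi$ is obtained from $T$ by removing all leaves together with their parental edges, followed by series reduction (removing each non-root vertex of degree $2$ and merging its two adjacent edges into one); $\mathcal{R}(\phi)=\phi$. *)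

(* Defs.v *)
From HB Require Import structures.
From mathcomp Require Import all_boot all_order all_algebra.
From mathcomp Require Import all_classical all_reals all_analysis.

Set Implicit Arguments.
Unset Strict Implicit.
Unset Printing Implicit Defensive.

Import Order.TTheory GRing.Theory Num.Theory.
Import numFieldNormedType.Exports.

Local Open Scope classical_set_scope.
Local Open Scope quotient_scope.

Inductive rtree := Node of seq rtree.

Definition children (t : rtree) : seq rtree := let: Node cs := t in cs.

Lemma rtree_rect_all (P : rtree -> Prop) :
  (forall cs, foldr (fun c p => P c /\ p) True cs -> P (Node cs)) -> forall t, P t.
Proof.
move=> H; fix IH 1 => -[cs]; apply: H.
by elim: cs => [|c cs IHcs] //=; split.
Qed.

Fixpoint rtree_encode (t : rtree) : GenTree.tree void :=
  let: Node cs := t in GenTree.Node 0 (map rtree_encode cs).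

Fixpoint rtree_decode (g : GenTree.tree void) : rtree :=
  match g with
  | GenTree.Leaf _ => Node [::]
  | GenTree.Node _ gs => Node (map rtree_decode gs)
  end.

Lemma rtree_encodeK : cancel rtree_encode rtree_decode.
Proof.
elim/rtree_rect_all => cs /= IH; congr Node.
by elim: cs IH => //= c cs IHcs [-> /IHcs ->].
Qed.

HB.instance Definition _ := Countable.copy rtree (can_type rtree_encodeK).

Lemma rtree_ind_in (P : rtree -> Prop) :
  (forall cs, {in cs, forall c, P c} -> P (Node cs)) -> forall t, P t.
Proof.
move=> H; elim/rtree_rect_all => cs IH; apply: H.
elim: cs IH => //= c cs IHcs [Pc /IHcs IH] d.
by rewrite inE => /predU1P[->|/IH].
Qed.

(* Isomorphism of rooted trees, i.e. equality up to reordering the offspring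
   of every vertex. *)
Fixpoint iso (s t : rtree) : bool :=
  let: Node cs := s in
  has (fun ds => all2 iso cs ds) (permutations (children t)).

Lemma isoP cs ds :
  reflect (exists2 ds', perm_eq ds' ds & all2 iso cs ds')
          (iso (Node cs) (Node ds)).
Proof.
apply: (iffP hasP) => -[ds' p a]; exists ds' => //.
  by rewrite mem_permutations in p.
by rewrite mem_permutations.
Qed.

Lemma all2_perm (T : eqType) (r : rel T) (s t t' : seq T) :
  all2 r s t -> perm_eq t' t -> exists2 s', perm_eq s' s & all2 r s' t'.
Proof.
case: s => [|x0 s]; first by case: t => // _ /perm_nilP ->; exists [::].
move: (x0 :: s) => {}s.
rewrite all2E => /andP[/eqP sz al].
move=> /(perm_iotaP x0)[Is pI ->].
exists (map (nth x0 s) Is).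
  by apply/(perm_iotaP x0); exists Is => //; rewrite sz.
rewrite all2E !size_map eqxx /=.
rewrite zip_map; apply/allP => /= -[a b] /mapP[i iI [-> ->]] /=.
have lti : i < size t by rewrite (perm_mem pI) mem_iota in iI.
move/allP: al => /(_ (nth x0 s i, nth x0 t i)); apply.
by rewrite -nth_zip // mem_nth // size_zip sz minnn.
Qed.

Lemma iso_refl : reflexive iso.
Proof.
elim/rtree_ind_in => cs IH; apply/isoP; exists cs => //.
elim: cs IH => //= c cs IHcs IH; rewrite IH ?mem_head //=.
by apply: IHcs => d d_cs; apply: IH; rewrite inE d_cs orbT.
Qed.

Lemma iso_sym_imp s t : iso s t -> iso t s.
Proof.
elim/rtree_ind_in: s t => cs IH [ds] /isoP[ds' p a].
have a' : all2 iso ds' cs.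
  elim: cs ds' IH a {p} => [|c cs IHcs] [|d ds'] //= IH /andP[cd a].
  rewrite IH ?mem_head //=; apply: IHcs => // e e_cs.
  by apply: IH; rewrite inE e_cs orbT.
have {}p : perm_eq ds ds' by rewrite perm_sym.
apply/isoP.
have [cs' pc a''] : exists2 cs', perm_eq cs' cs & all2 iso ds cs'.
  have flip (x y : seq rtree) : all2 iso x y = all2 (fun u v => iso v u) y x.
    by elim: x y => [|u x IHx] [|v y] //=; rewrite IHx.
  rewrite flip in a'.
  have [cs' pc a''] := all2_perm a' p.
  by exists cs' => //; rewrite flip.
by exists cs'.
Qed.

Lemma iso_sym : symmetric iso.
Proof. by move=> s t; apply/idP/idP; apply: iso_sym_imp. Qed.

Lemma iso_trans : transitive iso.
Proof.
move=> t s u; elim/rtree_ind_in: s t u => cs IH [ds] [es].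
move=> /isoP[ds' pd ad] /isoP[es' pe ae].
have flip (x y : seq rtree) : all2 iso x y = all2 (fun u v => iso v u) y x.
  by elim: x y => [|u x IHx] [|v y] //=; rewrite IHx.
rewrite flip in ae.
have [es'' pe' ae'] := all2_perm ae pd.
apply/isoP; exists es''; first exact: perm_trans pe' pe.
rewrite -flip in ae'.
elim: cs ds' es'' IH ad ae' {pd pe'} => [|c cs IHcs] [|d ds'] [|e es''] //= IH.
move=> /andP[cd ad] /andP[de ae'].
rewrite (IH _ (mem_head _ _) _ _ cd de) /=; apply: IHcs ad ae' => f f_cs.
by apply: IH; rewrite inE f_cs orbT.
Qed.

(* The numbers of offspring of all vertices, the root coming first. *)
Fixpoint offspring (t : rtree) : seq nat :=
  let: Node cs := t in size cs :: flatten (map offspring cs).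

Definition nonroot_offspring (t : rtree) : seq nat := behead (offspring t).

Definition planted (t : rtree) : bool := size (children t) <= 1.

(* A non-root vertex has degree 2 iff it has exactly one offspring. *)
Definition reduced (t : rtree) : bool := 1 \notin nonroot_offspring t.

Definition is_leaf (t : rtree) : bool := nilp (children t).

(* The root is never removed; [cut (Node [::]) = Node [::]]. *)
Fixpoint cut (t : rtree) : rtree :=
  let: Node cs := t in
  Node (pmap (fun c => if is_leaf c then None else Some (cut c)) cs).

(* Series reduction below and at a non-root vertex: a vertex with a single
   offspring is replaced by that offspring. *)
Fixpoint contract (t : rtree) : rtree :=
  let: Node cs := t in
  let cs' := map contract cs in
  if cs' is [:: c] then c else Node cs'.

Definition series_reduction (t : rtree) : rtree :=
  Node (map contract (children t)).

Definition prune_rtree (t : rtree) : rtree := series_reduction (cut t).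

Lemma is_leaf_iso s t : iso s t -> is_leaf s = is_leaf t.
Proof.
case: s t => [cs] [ds] /isoP[ds' /perm_size p].
rewrite all2E => /andP[/eqP sz _].
by rewrite /is_leaf /nilp /= sz p.
Qed.

Lemma cut_iso s t : iso s t -> iso (cut s) (cut t).
Proof.
elim/rtree_ind_in: s t => cs IH [ds] /isoP[ds' p a] /=.
apply/isoP; exists (pmap (fun c => if is_leaf c then None else Some (cut c)) ds').
  exact: perm_pmap.
elim: cs ds' IH a {p} => [|c cs IHcs] [|d ds'] //= IH /andP[cd a].
have a' := IHcs _ (fun e (h : e \in cs) => IH e (mem_behead (s := c :: cs) h)) a.
rewrite (is_leaf_iso cd); case: ifP => //= _.
by rewrite IH ?mem_head.
Qed.

Lemma contract_iso s t : iso s t -> iso (contract s) (contract t).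
Proof.
elim/rtree_ind_in: s t => cs IH [ds] /isoP[ds' p a] /=.
have {}a : all2 iso (map contract cs) (map contract ds').
  elim: cs ds' IH a {p} => [|c cs IHcs] [|d ds'] //= IH /andP[cd a].
  rewrite IH ?mem_head //=; apply: IHcs => // e e_cs.
  by apply: IH; rewrite inE e_cs orbT.
have {}p : perm_eq (map contract ds') (map contract ds) by exact: perm_map.
move: (map contract cs) (map contract ds) (map contract ds') p a.
move=> {ds ds' IH}cs ds ds' p a.
have [sz1 sz2] : size ds' = size ds /\ size cs = size ds'.
  by split; [exact: perm_size|move: a; rewrite all2E => /andP[/eqP]].
have i : iso (Node cs) (Node ds) by apply/isoP; exists ds'.
move: ds' ds cs sz1 sz2 p a i => [|d' [|??]] [|d [|??]] [|c [|??]] //= _ _ p.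
by move: p => /perm_consP[[|i] [u []]] //= [<- <-] _ /andP[].
Qed.

Lemma prune_rtree_iso s t : iso s t -> iso (prune_rtree s) (prune_rtree t).
Proof.
move=> /cut_iso; rewrite /prune_rtree /series_reduction.
case: (cut s) (cut t) => [cs] [ds] /isoP[ds' p a] /=.
apply/isoP; exists (map contract ds'); first exact: perm_map.
elim: cs ds' a {p} => [|c cs IHcs] [|d ds'] //= /andP[cd a].
by rewrite contract_iso // IHcs.
Qed.

Lemma prune_planted t : planted t -> planted (prune_rtree t).
Proof.
case: t => cs; rewrite /planted /prune_rtree /= size_map size_pmap.
exact/leq_trans/count_size.
Qed.

Lemma contract_reduced t : 1 \notin offspring (contract t).
Proof.
elim/rtree_ind_in: t => cs IH /=.
have H : {in map contract cs, forall d, 1 \notin offspring d}.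
  by move=> _ /mapP[c /IH ? ->].
case: (map contract cs) H => [//|c [|d ds]] H; first exact/H/mem_head.
rewrite -[offspring _]/(_ :: flatten (map offspring [:: c, d & ds])).
rewrite inE negb_or; apply/andP; split=> //.
by apply/negP => /flattenP[_ /mapP[e /H/negP ne ->]] /ne.
Qed.

Lemma prune_reduced t : reduced (prune_rtree t).
Proof.
rewrite /reduced /nonroot_offspring /=.
apply/negP => /flattenP[_ /mapP[_ /mapP[c _ ->] ->]].
exact/negP/contract_reduced.
Qed.

Record ordered_tree :=
  OrderedTree { rtree_of : rtree; _ : planted rtree_of && reduced rtree_of }.

HB.instance Definition _ := [isSub for rtree_of].
HB.instance Definition _ := [Countable of ordered_tree by <:].

Definition oiso (s t : ordered_tree) : bool := iso (val s) (val t).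

Lemma oiso_refl : reflexive oiso. Proof. by move=> t; apply: iso_refl. Qed.
Lemma oiso_sym : symmetric oiso. Proof. by move=> s t; apply: iso_sym. Qed.
Lemma oiso_trans : transitive oiso.
Proof. by move=> s t u; apply: iso_trans. Qed.

Canonical oiso_equiv := EquivRel oiso oiso_refl oiso_sym oiso_trans.

(* Unlabeled trees carry no order on offspring: they are isomorphism classes. *)
Definition tree := {eq_quot oiso}.
HB.instance Definition _ := Choice.on tree.
HB.instance Definition _ := EqQuotient.on tree.
HB.instance Definition _ := CanIsCountable (@reprK _ tree).

Definition ordered_phi : ordered_tree := @OrderedTree (Node [::]) isT.
Definition phi : tree := \pi_tree ordered_phi.

Lemma prune_subproof (t : ordered_tree) :
  planted (prune_rtree (val t)) && reduced (prune_rtree (val t)).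
Proof. by case: t => t /= /andP[/prune_planted -> _]; apply: prune_reduced. Qed.

Definition ordered_prune (t : ordered_tree) : ordered_tree :=
  OrderedTree (prune_subproof t).

Definition prune : tree -> tree := lift_op1 tree ordered_prune.

Lemma pi_prune : {morph \pi_tree : t / ordered_prune t >-> prune t}.
Proof.
move=> t; unlock prune; apply/eqmodP/prune_rtree_iso.
by rewrite -[iso _ _]/(oiso_equiv _ _) -(eqmodE oiso_equiv) reprK.
Qed.
Canonical pi_prune_morph := PiMorph1 pi_prune.

(* Both tree spaces are countable and carry the discrete sigma-algebra. *)
HB.instance Definition _ := isPointed.Build ordered_tree ordered_phi.
HB.instance Definition _ := isPointed.Build tree phi.

HB.instance Definition _ := @isMeasurable.Build default_measure_display
  ordered_tree (fun=> True) I (fun _ _ => I) (fun _ _ => I).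
HB.instance Definition _ := @isMeasurable.Build default_measure_display
  tree (fun=> True) I (fun _ _ => I) (fun _ _ => I).

Local Open Scope ring_scope.

(* The probability that the Galton-Watson family tree, with the siblings kept
   in birth order, equals [t]: the root has a single offspring, and by
   independence the other vertices contribute a product. *)
Definition gw_weight (R : realType) (q : nat -> R) (t : ordered_tree) : R :=
  if size (children (val t)) == 1%N
  then \prod_(k <- nonroot_offspring (val t)) q k else 0.

Definition ordered_GW (R : realType) (q : nat -> R) (A : set ordered_tree) :
  \bar R := (\esum_(t in A) (gw_weight q t)%:E)%E.

(* The law of the unlabeled tree, obtained by forgetting the order of siblings. *)
Definition GW (R : realType) (q : nat -> R) : set tree -> \bar R :=
  pushforward (ordered_GW q) \pi_tree.

Definition IGW_half (R : realType) : set tree -> \bar R :=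
  GW (fun k => if (k == 0)%N || (k == 2)%N then 2^-1 else 0 : R).

Definition conditional (R : realType) (nu : set tree -> \bar R) (B : set tree) :
  set tree -> \bar R := fun A => (nu (A `&` B) / nu B)%E.

Definition gen_fun (R : realType) (q : nat -> R) (z : R) : R :=
  limn (pseries q z).

Definition S_fun (R : realType) (q : nat -> R) (z : R) : R :=
  (gen_fun q z - z * derive1 (gen_fun q) z) / (1 - derive1 (gen_fun q) z).

Definition critical_distribution (R : realType) (q : nat -> R) : Prop :=
  [/\ forall k, 0 <= q k,
      (\sum_(0 <= k <oo) (q k)%:E = 1)%E
    & (\sum_(0 <= k <oo) (k%:R * q k)%:E = 1)%E].

(* Main.v *)
Require Import Defs.
From HB Require Import structures.
From mathcomp Require Import all_boot all_order all_algebra.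
From mathcomp Require Import all_classical all_reals all_analysis.
From mathcomp Require Import finmap ring lra.

Set Implicit Arguments.
Unset Strict Implicit.
Unset Printing Implicit Defensive.

Import Order.TTheory GRing.Theory Num.Theory.
Import numFieldNormedType.Exports.

Local Open Scope classical_set_scope.
Local Open Scope ring_scope.

(** Let [Q] be the generating function of a critical offspring law [q] with
    [q_1 = 0].

    Pruning a Galton-Watson tree thins the offspring of every vertex: a child
    survives unless it is a leaf, so with probability [1 - q_0], independently
    of its siblings.  Series reduction then deletes the vertices with one
    surviving child and conditions the others.  Hence the pruned tree, given
    that it is not reduced to its root, is again a Galton-Watson tree
    ([conditional_prune_GW]), with offspring law [pruned q (q 0)], where
    [pruned q p] has the generating function
    [z |-> (Q (p + (1 - p) z) - p - (1 - p) Q'(p) z) / ((1 - p) (1 - Q'(p)))].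
    At the level of single trees this says that the total weight of the trees
    pruned to [s] is [(1 - q_0)] times the new weight of [s]
    ([pruned_weight]); it rests on the weight of the forests with a prescribed
    list of survivors ([esum_forest]) and on the almost sure finiteness of a
    critical tree ([tree_mass1]).

    Prunings compose: [pruned (pruned q p) s = pruned q (p + (1 - p) s)]
    ([pruned_pruned]).  So [k] prunings amount to one thinning at a level
    [p_k], where [p_0 = 0] and [p_(k+1) = p_k + (1 - p_k) r(p_k)] with
    [r(p) = pruned q p 0] the new leaf probability.  Criticality and the
    absence of single children give [sum_n (n - 2) q_n = -1], which forces
    [q_0 >= 1 / 2] ([sums_excess]); thus [1 - p_k <= 2 ^ - k].  The same
    identity shows that all weight other than that of 0 and 2 is at most
    [2 q_0 - 1], so that the theorem reduces to [r(p) -> 1 / 2] as [p -> 1].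

    Put [g(u) = Q (1 - u) - (1 - u)], so that [r(1 - u) = g(u) / (u g'(u))].
    With a finite second moment, [2 g - u g'] is negligible with respect to
    [u ^ 2] by dominated convergence, while [u g'] is at least of order [u ^ 2]
    ([finite_variance_leaf_tends_to_half]).  In the other case
    [(1 - S(x)) / (1 - x) = 1 - r(x)] ([S_fun_leaf]), so that [r] has a limit;
    if it were [b > 1 / 2] then [u g' <= a g] near 0 for some [a < 2], which by
    convexity of [g] gives [g(u) >= const * u ^ a] along a geometric sequence,
    against the bound [g(u) <= const * u ^ s] that the moment of order [s]
    provides for [a < s < 2] ([moments_leaf_lt]). *)

(** * Convergent series *)

(** Locked, because convergence unfolds to a quantification over neighbourhoods
    that unification would otherwise enter. *)
HB.lock Definition sums (R : realType) (u : nat -> R) (s : R) : Prop :=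
  series u @ \oo --> s.

Section Series.
Variable R : realType.
Implicit Types (u v f : nat -> R) (s t c : R).

Lemma sumsP u s : sums u s <-> series u @ \oo --> s.
Proof. by rewrite sums.unlock. Qed.

Lemma sums_unique u s t : sums u s -> sums u t -> s = t.
Proof. by move=> /sumsP us /sumsP; exact: cvg_unique us. Qed.

Lemma sums_lim u s : sums u s -> limn (series u) = s.
Proof. by move=> /sumsP us; exact: cvg_lim us. Qed.

Lemma sums_cvg u s : sums u s -> cvgn (series u).
Proof. by move=> /sumsP us; apply/cvg_ex; exists s. Qed.

Lemma cvg_sums u : cvgn (series u) -> sums u (limn (series u)).
Proof. by move=> us; apply/sumsP. Qed.

Lemma eq_sums u v s : u =1 v -> sums u s -> sums v s.
Proof. by move=> /funext ->. Qed.

Lemma sums_nneseries u s : sums u s -> (\sum_(0 <= k <oo) (u k)%:E = s%:E)%E.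
Proof.
move=> /sumsP us; apply/cvg_lim => //.
rewrite (_ : (fun n => _) = EFin \o series u).
  by apply: cvg_EFin; [apply: nearW => n|exact: us].
by apply/funext => n /=; rewrite sumEFin.
Qed.

Lemma nneseries_sums u s : (forall n, 0 <= u n) ->
  (\sum_(0 <= k <oo) (u k)%:E = s%:E)%E -> sums u s.
Proof.
move=> u0 us; have /cvg_sums cu : cvgn (series u).
  by apply: nnseries_is_cvg => //; rewrite us ltry.
suff <- : limn (series u) = s by [].
by apply: EFin_inj; rewrite -us; apply/esym/sums_nneseries.
Qed.

Lemma sumsD u v s t : sums u s -> sums v t -> sums (fun n => u n + v n) (s + t).
Proof.
move=> /sumsP us /sumsP vt; apply/sumsP.
by rewrite -[fun n => _]/(u + v) seriesD; exact: cvgD.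
Qed.

Lemma sumsZ c u s : sums u s -> sums (fun n => c * u n) (c * s).
Proof.
move=> /sumsP us; apply/sumsP.
by rewrite -[fun n => _]/(c *: u) seriesZ; apply: cvgZ => //; exact: cvg_cst.
Qed.

Lemma sumsB u v s t : sums u s -> sums v t -> sums (fun n => u n - v n) (s - t).
Proof.
move=> us vt; apply: (@eq_sums (fun n => u n + -1 * v n)) => [n|].
  by rewrite mulN1r.
by rewrite -(mulN1r t); apply: sumsD => //; exact: sumsZ.
Qed.

Lemma sums_delta m c : sums (fun n => (n == m)%:R * c) c.
Proof.
apply/sumsP; apply: cvg_near_cst; near=> n; rewrite /series /=.
have mn : (m < n)%N by near: n; exact: nbhs_infty_gt.
rewrite big_mkord (bigD1 (Ordinal mn)) //= eqxx mul1r big1 ?addr0 // => i ne.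
by rewrite (_ : (i == m :> nat) = false) ?mul0r //; apply/negbTE.
Unshelve. all: by end_near. Qed.

Lemma sums_le u v s t : (forall n, u n <= v n) -> sums u s -> sums v t -> s <= t.
Proof.
move=> uv us vt; rewrite -(sums_lim us) -(sums_lim vt).
by apply: lim_series_le => //; [exact: sums_cvg us|exact: sums_cvg vt].
Qed.

Lemma sums_term u s n : (forall k, 0 <= u k) -> sums u s -> u n <= s.
Proof.
move=> u0 us; apply: (sums_le _ (sums_delta n (u n)) us) => k.
by case: eqP => [->|_]; rewrite ?mulr1n ?mulr0n ?mul1r ?mul0r.
Qed.

Lemma sums_dominated u v t : (forall n, 0 <= u n <= v n) -> sums v t ->
  sums u (limn (series u)).
Proof.
move=> uv vt; have u0 n : 0 <= u n by case/andP: (uv n).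
have leuv n : u n <= v n by case/andP: (uv n).
apply: cvg_sums.
apply: (series_le_cvg u0 (fun n => le_trans (u0 n) (leuv n)) leuv).
exact: sums_cvg vt.
Qed.

Lemma sums_ge0 u s : (forall n, 0 <= u n) -> sums u s -> 0 <= s.
Proof. by move=> u0 us; exact: le_trans (u0 0%N) (sums_term 0 u0 us). Qed.

Lemma sums_finite u m : (forall n, (m < n)%N -> u n = 0) ->
  sums u (\sum_(n < m.+1) u n).
Proof.
move=> u0; apply/sumsP; apply: cvg_near_cst; near=> n; rewrite /series /=.
have mn : (m.+1 <= n)%N by near: n; exact: nbhs_infty_ge.
rewrite (big_cat_nat _ mn) //= big_mkord [X in _ + X]big_nat_cond [X in _ + X]big1 ?addr0 //.
by move=> i /andP[/andP[mi _] _]; exact: u0.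
Unshelve. all: by end_near. Qed.

End Series.

(** * Re-expansion of a monomial *)

Section BinomialSum.
Variable R : comPzRingType.

Lemma bin_mulC k m j : ('C(m + j, m) * 'C(m + k, m + j) = 'C(m + k, m) * 'C(k, j))%N.
Proof.
have [kj|jk] := ltnP k j; first by rewrite (bin_small kj) ['C(m + k, _)]bin_small ?muln0 ?ltn_add2l.
have F : (0 < m`! * (j`! * (k - j)`!))%N by rewrite !muln_gt0 !fact_gt0.
apply/eqP; rewrite -(eqn_pmul2r F); apply/eqP.
have E1 : ('C(m + j, m) * (m`! * j`!) = (m + j)`!)%N.
  by rewrite -{2}(addKn m j) bin_fact // leq_addr.
have E2 : ('C(m + k, m + j) * ((m + j)`! * (k - j)`!) = (m + k)`!)%N.
  by rewrite -(subnDl m) bin_fact // leq_add2l.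
have E3 : ('C(m + k, m) * (m`! * k`!) = (m + k)`!)%N.
  by rewrite -{2}(addKn m k) bin_fact // leq_addr.
have E4 : ('C(k, j) * (j`! * (k - j)`!) = k`!)%N by rewrite bin_fact.
transitivity ('C(m + j, m) * (m`! * j`!) * ('C(m + k, m + j) * (k - j)`!))%N; first by ring.
rewrite E1; transitivity ((m + k)`!); first by rewrite -E2; ring.
by rewrite -E3 -E4; ring.
Qed.

(** Both sides are the [m]-th divided derivative in [r] of [(p + x r) ^ k], the
    left one computed on the binomial expansion. *)
Lemma binomial_reexpansion (p x r : R) (k m : nat) :
  \sum_(n < k.+1) 'C(k, n)%:R * p ^+ (k - n) * x ^+ n * ('C(n, m)%:R * r ^+ (n - m))
  = x ^+ m * ('C(k, m)%:R * (p + x * r) ^+ (k - m)).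
Proof.
have [km|mk] := ltnP k m.
  rewrite bin_small // mul0r mulr0 big1 // => i _.
  by rewrite ['C(i, m)]bin_small ?mul0r ?mulr0 // (leq_trans _ km).
rewrite -(big_mkord xpredT (fun n => 'C(k, n)%:R * p ^+ (k - n) * x ^+ n * ('C(n, m)%:R * r ^+ (n - m)))).
rewrite (@big_cat_nat _ _ _ m) ?leqW //= big_nat_cond big1 ?add0r; last first.
  by move=> i /andP[/andP[_ im] _]; rewrite ['C(i, m)]bin_small ?mul0r ?mulr0.
move: mk => /subnKC <-; move: (k - m)%N => {}k.
rewrite -{1}(add0n m) -addnS big_addn !addKn big_mkord.
rewrite exprDn !mulr_sumr; apply: eq_bigr => i _.
rewrite addnK -mulr_natl [(i + m)%N]addnC subnDl exprD exprMn.
have := bin_mulC k m i => /(congr1 (fun n => n%:R : R)); rewrite !natrM => E.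
transitivity ('C(m + i, m)%:R * 'C(m + k, m + i)%:R * p ^+ (k - i) * x ^+ m * x ^+ i * r ^+ i); first by ring.
by rewrite E; ring.
Qed.

End BinomialSum.

(** * Critical offspring laws *)

Record critical_offspring (R : realType) (q : nat -> R) : Prop :=
  CriticalOffspring {
    co_ge0 : forall k, 0 <= q k;
    co_sum : sums q 1;
    co_mean : sums (fun k => k%:R * q k) 1;
    co_1 : q 1%N = 0 }.

(** The coefficient [Q^(m)(p) / m!] of the Taylor expansion at [p] of the
    generating function [Q] of [q]. *)
Definition taylor (R : realType) (q : nat -> R) (p : R) (m : nat) : R :=
  limn (series (fun k => q k * ('C(k, m)%:R * p ^+ (k - m)))).

(** Thin the offspring, each child surviving with probability [1 - p]; remove mass
    [p] from the value 0 and all mass from the value 1; renormalise.  For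
    [p = q 0] the lost children are the leaves, the mass removed at 0 is that of
    the vertices that were leaves before thinning, and the mass at 1 that of the
    vertices deleted by series reduction. *)
Definition pruned (R : realType) (q : nat -> R) (p : R) (m : nat) : R :=
  if m == 1%N then 0
  else (taylor q p m * (1 - p) ^+ m - (m == 0%N)%:R * p)
       / ((1 - p) * (1 - taylor q p 1)).

Lemma critical_distribution_offspring (R : realType) (q : nat -> R) :
  critical_distribution q -> q 1%N = 0 -> critical_offspring q.
Proof.
move=> [q0 qs qm] q1; split=> //; apply: nneseries_sums => // k.
by rewrite mulr_ge0.
Qed.

Lemma bernoulli (R : realDomainType) (p : R) k : 0 <= p <= 1 -> 1 - k%:R * (1 - p) <= p ^+ k.
Proof.
move=> /andP[p0 p1]; elim: k => [|k IH]; first by rewrite mul0r subr0 expr0.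
rewrite exprS; apply: le_trans (ler_wpM2l p0 IH).
rewrite -natr1 -subr_ge0 (_ : _ - _ = k%:R * (1 - p) ^+ 2); last by ring.
by rewrite mulr_ge0 ?sqr_ge0.
Qed.

Lemma binomial_weight_le1 (R : realDomainType) (p : R) k m : 0 <= p <= 1 ->
  'C(k, m)%:R * p ^+ (k - m) * (1 - p) ^+ m <= 1.
Proof.
move=> /andP[p0 p1]; have [km|mk] := ltnP k m; first by rewrite bin_small // !mul0r.
have E : (p + (1 - p)) ^+ k = 1 by rewrite addrC subrK expr1n.
have mk1 : (m < k.+1)%N by [].
rewrite -[leRHS]E [leRHS]exprDn (bigD1 (Ordinal mk1)) //= -[X in _ <= X + _]mulr_natl mulrA lerDl.
by apply: sumr_ge0 => i _; rewrite mulrn_wge0 // mulr_ge0 // exprn_ge0 // subr_ge0.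
Qed.

Section Critical.
Variables (R : realType) (q : nat -> R).
Hypothesis hq : critical_offspring q.
Let q0 := co_ge0 hq.

(** The binomial weight of [m] survivors is at most 1, so the series is dominated
    by [(1 - p) ^ - m] times the mass of [q]. *)
Lemma sums_taylor (p : R) m : 0 <= p < 1 ->
  sums (fun k => q k * ('C(k, m)%:R * p ^+ (k - m))) (taylor q p m).
Proof.
move=> /andP[p0 p1]; have d : 0 < (1 - p) ^+ m by rewrite exprn_gt0 // subr_gt0.
apply: (@sums_dominated _ _ (fun k => ((1 - p) ^+ m)^-1 * q k) _ _ (sumsZ _ (co_sum hq))) => k.
rewrite !mulr_ge0 ?exprn_ge0 //= [leRHS]mulrC ler_wpM2l //.
by rewrite -[leRHS]mul1r ler_pdivlMr // binomial_weight_le1 // p0 ltW.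
Qed.

Lemma sums_taylor0_at1 : sums (fun k => q k * ('C(k, 0)%:R * 1 ^+ (k - 0))) 1.
Proof. by apply: eq_sums (co_sum hq) => k; rewrite bin0 expr1n !mulr1. Qed.

Lemma sums_taylor1_at1 : sums (fun k => q k * ('C(k, 1)%:R * 1 ^+ (k - 1))) 1.
Proof. by apply: eq_sums (co_mean hq) => k; rewrite bin1 expr1n mulr1 mulrC. Qed.

(** Thinning by [p] and re-expanding at [r] is re-expansion at [p + (1 - p) r]:
    exchange the two sums of nonnegative terms, the inner one being finite.
    [r = 1] is allowed, which yields the mass and the mean of the thinned law. *)
Lemma taylor_reexpansion (p r S : R) m : 0 <= p < 1 -> 0 <= r ->
  sums (fun k => q k * ('C(k, m)%:R * (p + (1 - p) * r) ^+ (k - m))) S ->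
  sums (fun n => taylor q p n * (1 - p) ^+ n * ('C(n, m)%:R * r ^+ (n - m)))
       ((1 - p) ^+ m * S).
Proof.
move=> p01 r0 hS; have /andP[p0 p1] := p01.
have x0 : 0 <= 1 - p by rewrite subr_ge0 ltW.
have ta0 n : 0 <= taylor q p n.
  by apply: sums_ge0 (sums_taylor n p01) => k; rewrite !mulr_ge0 ?exprn_ge0.
apply: nneseries_sums => [n|]; first by rewrite !mulr_ge0 ?exprn_ge0.
pose a n k : R := 'C(k, n)%:R * p ^+ (k - n) * (1 - p) ^+ n * ('C(n, m)%:R * r ^+ (n - m)).
have a0 n k : 0 <= a n k by rewrite !mulr_ge0 ?exprn_ge0.
rewrite (eq_eseriesr (g := fun n => \sum_(0 <= k <oo) (q k * a n k)%:E)%E); last first.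
  move=> n _; apply/esym/sums_nneseries.
  rewrite -mulrA mulrC; apply: eq_sums (sumsZ _ (sums_taylor n p01)) => k.
  by rewrite /a; ring.
rewrite nneseries_interchange; last by move=> n k; rewrite lee_fin mulr_ge0.
rewrite (eq_eseriesr (g := fun k => ((1 - p) ^+ m * (q k * ('C(k, m)%:R * (p + (1 - p) * r) ^+ (k - m))))%:E)%E); last first.
  move=> k _; apply: sums_nneseries.
  rewrite mulrCA -binomial_reexpansion mulr_sumr.
  apply: (@sums_finite _ (fun n => q k * a n k)) => n kn.
  by rewrite /a bin_small // !mul0r mulr0.
by apply: sums_nneseries; exact: sumsZ.
Qed.

Lemma critical_atom : exists2 n, (1 < n)%N & 0 < q n.
Proof.
apply: contrapT => no; have : (1 : R) = 0; last by move/eqP; rewrite oner_eq0.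
apply: sums_unique (co_mean hq) _.
apply: (@eq_sums _ (fun k => (k == 0)%N%:R * 0)); last exact: sums_delta.
case=> [|[|k]]; rewrite ?mul0r ?mulr0 ?(co_1 hq) ?mulr0 //.
suff -> : q k.+2 = 0 by rewrite mulr0.
by apply/eqP; rewrite eq_le q0 andbT leNgt; apply/negP => qk; apply: no; exists k.+2.
Qed.

(** One atom [n > 1] of [q] already bounds [1 - Q'(p)] below by a multiple of
    [1 - p].  This gives the positivity of the denominators, and the order of
    magnitude of [u g'(u)] needed in the finite variance case. *)
Lemma taylor1_lt1_linear :
  exists2 c : R, 0 < c & forall p, 0 <= p < 1 -> c * (1 - p) <= 1 - taylor q p 1.
Proof.
have [n n1 qn] := critical_atom.
exists (q n); rewrite // => p p01; have /andP[p0 p1] := p01.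
have h := sumsB (co_mean hq) (sums_taylor 1 p01).
apply: (sums_le _ (sums_delta n (q n * (1 - p))) h) => k.
have pk j : p ^+ j <= 1 by apply: exprn_ile1 => //; exact: ltW.
rewrite bin1 (_ : k%:R * q k - _ = q k * (k%:R * (1 - p ^+ (k - 1)))); last by ring.
case: eqP => [->|_]; rewrite ?mulr1n ?mulr0n ?mul1r ?mul0r; last first.
  by rewrite !mulr_ge0 // subr_ge0.
rewrite ler_wpM2l // -[leLHS]mul1r ler_pM //.
- by rewrite subr_ge0 ltW.
- by rewrite ler1n ltnW.
- by rewrite lerB // ler_iXnr ?subn_gt0 // ltW.
Qed.

End Critical.

(** * The offspring law after pruning *)

Section Pruned.
Variables (R : realType) (q : nat -> R).
Hypothesis hq : critical_offspring q.
Let q0 := co_ge0 hq.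

Lemma taylor1_lt1 (p : R) : 0 <= p < 1 -> taylor q p 1 < 1.
Proof.
move=> p01; have [c c0 /(_ p p01)] := taylor1_lt1_linear hq.
rewrite -(subr_gt0 _ 1); apply: lt_le_trans.
by rewrite mulr_gt0 // subr_gt0; case/andP: p01.
Qed.

Lemma taylor_ge0 (p : R) m : 0 <= p < 1 -> 0 <= taylor q p m.
Proof.
move=> p01; apply: sums_ge0 (sums_taylor hq m p01) => k.
by rewrite !mulr_ge0 ?exprn_ge0 //; case/andP: p01.
Qed.

Lemma pruned_den_gt0 (p : R) : 0 <= p < 1 -> 0 < (1 - p) * (1 - taylor q p 1).
Proof.
by move=> p01; rewrite mulr_gt0 // subr_gt0; [case/andP: p01|exact: taylor1_lt1].
Qed.

(** Bernoulli's inequality: [Q] lies above its tangent at 1, the diagonal. *)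
Lemma taylor0_ge (p : R) : 0 <= p < 1 -> p <= taylor q p 0.
Proof.
move=> p01; have /andP[p0 p1] := p01.
have h := sumsB (co_sum hq) (sumsZ (1 - p) (co_mean hq)).
rewrite [leLHS](_ : p = 1 - (1 - p) * 1); last by ring.
apply: (sums_le _ h (sums_taylor hq 0 p01)) => k.
rewrite bin0 mul1r subn0 (_ : q k - _ = q k * (1 - k%:R * (1 - p))); last by ring.
by rewrite ler_wpM2l // bernoulli // p0 ltW.
Qed.

(** The law [pruned q p] is the thinned law corrected at 0 and 1 and divided by a
    constant; taking [r = 1] gives its mass and mean, and [r < 1] the effect of a
    second pruning. *)
Lemma pruned_reexpansion (p r S : R) m : 0 <= p < 1 -> 0 <= r ->
  sums (fun k => q k * ('C(k, m)%:R * (p + (1 - p) * r) ^+ (k - m))) S ->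
  sums (fun n => pruned q p n * ('C(n, m)%:R * r ^+ (n - m)))
       (((1 - p) ^+ m * S - p * 'C(0, m)%:R
          - taylor q p 1 * (1 - p) * ('C(1, m)%:R * r ^+ (1 - m)))
        / ((1 - p) * (1 - taylor q p 1))).
Proof.
move=> p01 r0 /(taylor_reexpansion hq p01 r0) h.
have := sumsB (sumsB h (sums_delta 0 (p * 'C(0, m)%:R)))
              (sums_delta 1 (taylor q p 1 * (1 - p) * ('C(1, m)%:R * r ^+ (1 - m)))).
move=> /(sumsZ ((1 - p) * (1 - taylor q p 1))^-1) h'.
rewrite mulrC; apply: eq_sums h' => n; rewrite /pruned.
case: n => [|[|n]] /=; rewrite ?mulr0n ?mulr1n ?sub0n ?expr0 ?expr1.
- by ring.
- by ring.
- by ring.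
Qed.

Lemma pruned_critical (p : R) : 0 <= p < 1 -> critical_offspring (pruned q p).
Proof.
move=> p01; have /andP[p0 p1] := p01; have D0 := pruned_den_gt0 p01.
have pp : p + (1 - p) * 1 = 1 by ring.
split=> [k|||] //.
- rewrite /pruned; case: eqP => // _; rewrite divr_ge0 ?(ltW D0) //.
  case: k => [|k] /=; first by rewrite expr0 mulr1 mul1r subr_ge0 taylor0_ge.
  by rewrite mul0r subr0 mulr_ge0 ?taylor_ge0 ?exprn_ge0 // subr_ge0 ltW.
- have := @pruned_reexpansion p 1 1 0 p01 ler01; rewrite pp => /(_ (sums_taylor0_at1 hq)).
  rewrite !bin0 !expr1n !mulr1 ?expr0 [X in X / _](_ : _ = (1 - p) * (1 - taylor q p 1)); last by ring.
  rewrite divff ?gt_eqF //; apply: eq_sums => n.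
  by rewrite bin0 expr1n !mulr1.
- have := @pruned_reexpansion p 1 1 1 p01 ler01; rewrite pp => /(_ (sums_taylor1_at1 hq)).
  rewrite bin_small // bin1 !expr1n !mulr1 expr1 [X in X / _](_ : _ = (1 - p) * (1 - taylor q p 1)); last by ring.
  rewrite divff ?gt_eqF //; apply: eq_sums => n.
  by rewrite bin1 expr1n !mulr1 mulrC.
Qed.

(** The correction made at 0 and 1 by the first pruning is absorbed by the one
    made by the second, so only the thinnings remain, and these compose. *)
Lemma pruned_pruned (p r : R) : 0 <= p < 1 -> 0 <= r < 1 ->
  pruned (pruned q p) r = pruned q (p + (1 - p) * r).
Proof.
move=> p01 r01; have /andP[p0 p1] := p01; have /andP[r0 r1] := r01.
set p' := p + _.
have p'1 : 1 - p' = (1 - p) * (1 - r) by rewrite /p'; ring.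
have p'01 : 0 <= p' < 1.
  rewrite /p' addr_ge0 ?mulr_ge0 ?subr_ge0 ?(ltW p1) //=.
  by rewrite -subr_gt0 p'1 mulr_gt0 // subr_gt0.
have t m : taylor (pruned q p) r m = ((1 - p) ^+ m * taylor q p' m - p * 'C(0, m)%:R
          - taylor q p 1 * (1 - p) * ('C(1, m)%:R * r ^+ (1 - m)))
        / ((1 - p) * (1 - taylor q p 1)).
  apply: sums_unique (sums_taylor (pruned_critical p01) _ r01) _.
  exact: pruned_reexpansion p01 r0 (sums_taylor hq _ p'01).
have t1 : 1 - taylor q p 1 != 0 by rewrite gt_eqF // subr_gt0 taylor1_lt1.
have t2 : 1 - taylor q p' 1 != 0 by rewrite gt_eqF // subr_gt0 taylor1_lt1.
have np : 1 - p != 0 by rewrite gt_eqF // subr_gt0.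
have nr : 1 - r != 0 by rewrite gt_eqF // subr_gt0.
have tt1 : 1 - taylor (pruned q p) r 1 = (1 - taylor q p' 1) / (1 - taylor q p 1).
  by rewrite t bin_small // bin1 expr0 expr1; field; rewrite t1 np.
apply/funext => m; rewrite /pruned -/(pruned q p) tt1 t p'1.
case: m => [|[|m]] //=.
- by rewrite !bin0 /p'; field; rewrite t1 np nr t2.
- by rewrite !bin_small // exprMn; field; rewrite t1 np nr t2.
Qed.

Lemma pruned0 : pruned q 0 = q.
Proof.
have t m : taylor q 0 m = q m.
  have z : 0 <= (0 : R) < 1 by rewrite lexx ltr01.
  apply: sums_unique (sums_taylor hq m z) _.
  apply: eq_sums (sums_delta m (q m)) => k.
  case: eqP => [->|/eqP ne]; first by rewrite binn subnn expr0 mul1r !mulr1.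
  rewrite mul0r; case: (ltnP k m) => km; first by rewrite bin_small // mul0r mulr0.
  by rewrite expr0n subn_eq0 leqNgt ltn_neqAle eq_sym ne km /= !mulr0.
apply/funext => m; rewrite /pruned !t (co_1 hq); case: eqP => [->|_]; first by rewrite (co_1 hq).
by rewrite subr0 expr1n mulr0 subr0 !mulr1 invr1 mulr1.
Qed.


(** Criticality gives [sum_n (n - 2) q_n = -1].  Only the leaves contribute
    negatively, so replacing [n - 2] by its positive part adds [2 q_0]. *)
Lemma sums_excess : sums (fun n => (n - 2)%:R * q n) (2 * q 0%N - 1).
Proof.
have := sumsD (sumsB (co_mean hq) (sumsZ 2 (co_sum hq))) (sums_delta 0 (2 * q 0%N)).
rewrite (_ : 1 - 2 * 1 + 2 * q 0%N = 2 * q 0%N - 1); last by ring.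
apply: eq_sums => -[|[|n]] /=.
- by rewrite !mul0r mul1r sub0r addNr.
- by rewrite (co_1 hq); ring.
- by rewrite mul0r addr0 -mulrBl !subSS subn0 -[n.+2]addn2 natrD addrK.
Qed.

Lemma critical_leaf_ge_half : 1 / 2 <= q 0%N < 1.
Proof.
have e0 k : 0 <= (k - 2)%:R * q k by rewrite mulr_ge0.
apply/andP; split; first by have := sums_ge0 e0 sums_excess; lra.
have [n n1 qn] := critical_atom hq.
have : q 0%N + q n <= 1; last lra.
apply: (sums_le _ (sumsD (sums_delta 0 (q 0%N)) (sums_delta n (q n))) (co_sum hq)) => k.
case: (eqVneq k 0%N) => [->|_].
  by rewrite eq_sym gtn_eqF ?(ltnW n1) // mul1r mul0r addr0.
by rewrite mul0r add0r; case: eqVneq => [->|_]; rewrite ?mul1r ?mul0r.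
Qed.

Lemma critical_tail_le m : (2 < m)%N -> q m <= 2 * q 0%N - 1.
Proof.
move=> m2; have e0 k : 0 <= (k - 2)%:R * q k by rewrite mulr_ge0.
apply: le_trans (sums_term m e0 sums_excess).
by rewrite -[leLHS]mul1r ler_wpM2r // ler1n subn_gt0.
Qed.

(** The mass outside 0 and 2 is at most [2 q_0 - 1]. *)
Lemma critical_q2 : `|q 2%N - (1 - q 0%N)| <= 2 * q 0%N - 1.
Proof.
have := sumsB (sumsB (co_sum hq) (sums_delta 0 (q 0%N))) (sums_delta 2 (q 2%N)).
set s := _ - _ - _ => h.
have e k : 0 <= q k - (k == 0)%N%:R * q 0%N - (k == 2)%N%:R * q 2%N <= (k - 2)%:R * q k.
  case: k => [|[|[|k]]] /=; rewrite ?mul1r ?mul0r ?subr0 ?subrr ?(co_1 hq) ?mulr0 ?lexx //.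
  by rewrite q0 /= -[leLHS]mul1r ler_wpM2r // ler1n.
have s0 : 0 <= s by apply: sums_ge0 h => k; case/andP: (e k).
have s1 : s <= 2 * q 0%N - 1 by apply: (sums_le _ h sums_excess) => k; case/andP: (e k).
by rewrite distrC (_ : _ - q 2%N = s) ?ger0_norm // /s; ring.
Qed.

End Pruned.

(** The leaf probability of [pruned q p] is at least one half, hence positive;
    its numerator is the gap between [Q] and the diagonal. *)
Lemma taylor0_gt (R : realType) (q : nat -> R) (p : R) :
  critical_offspring q -> 0 <= p < 1 -> p < taylor q p 0.
Proof.
move=> hq p01; have /andP[h _] := critical_leaf_ge_half (pruned_critical hq p01).
have D0 := pruned_den_gt0 hq p01.
have : 0 < pruned q p 0 by apply: lt_le_trans h; lra.
by rewrite /pruned /= mul1r expr0 mulr1 pmulr_lgt0 ?invr_gt0 // subr_gt0.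
Qed.

(** * Sums over forests *)

Section Esum.
Variable R : realType.

Lemma le_esumZl (T : choiceType) (S : set T) (c : R) (a : T -> \bar R) :
  0 <= c -> (forall i, (0 <= a i)%E) ->
  (\esum_(i in S) (c%:E * a i) <= c%:E * \esum_(i in S) a i)%E.
Proof.
move=> c0 a0; apply: ge_ereal_sup => _ [A [finA AS] <-].
rewrite -ge0_mule_fsumr //; apply: lee_wpmul2l; first by rewrite lee_fin.
by apply: ereal_sup_ubound; exists A.
Qed.

Lemma esumZl (T : choiceType) (S : set T) (c : R) (a : T -> \bar R) :
  0 <= c -> (forall i, (0 <= a i)%E) ->
  (\esum_(i in S) (c%:E * a i) = c%:E * \esum_(i in S) a i)%E.
Proof.
move=> c0 a0; apply/eqP; rewrite eq_le le_esumZl //=.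
have [->|nc] := eqVneq c 0; first by rewrite mul0e; apply: esum_ge0 => i _; rewrite mul0e.
have cV : 0 <= c^-1 by rewrite invr_ge0.
have -> : (\esum_(i in S) a i = \esum_(i in S) ((c^-1)%:E * (c%:E * a i)))%E.
  by apply: eq_esum => i _; rewrite muleA -EFinM mulVf // mul1e.
apply: (@le_trans _ _ (c%:E * ((c^-1)%:E * \esum_(i in S) (c%:E * a i)))%E).
  apply: lee_wpmul2l; first by rewrite lee_fin.
  by apply: le_esumZl => // i; rewrite mule_ge0 ?lee_fin.
by rewrite muleA -EFinM mulfV // mul1e.
Qed.

Lemma esum_subset (T : choiceType) (S1 S2 : set T) (a : T -> \bar R) :
  S1 `<=` S2 -> (\esum_(i in S1) a i <= \esum_(i in S2) a i)%E.
Proof.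
move=> S12; apply: ereal_sup_le => _ [A [finA AS] <-]; exists A => //.
by split=> //; exact: subset_trans AS S12.
Qed.

Lemma esum_seq_cons (T : choiceType) (w : T -> R) (A : set T) (B : set (seq T)) (b : R) :
  (forall c, 0 <= w c) ->
  (\esum_(s in B) (\prod_(c <- s) w c)%:E = b%:E)%E ->
  (\esum_(s in [set c :: s | c in A & s in B]) (\prod_(c <- s) w c)%:E
   = b%:E * \esum_(c in A) (w c)%:E)%E.
Proof.
move=> w0 hB; have p0 s : 0 <= \prod_(c <- s) w c by apply: prodr_ge0.
have b0 : 0 <= b by rewrite -lee_fin -hB; apply: esum_ge0 => s _; rewrite lee_fin.
rewrite (reindex_esum (A `*` B) _ (fun z => z.1 :: z.2)); last first.
  split.
  - by move=> [c s] [/= Ac Bs]; exists c => //; exists s.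
  - by move=> [c s] [d t] _ _ [-> ->].
  - by move=> _ [c Ac [s Bs <-]]; exists (c, s).
transitivity (\esum_(c in A) \esum_(s in B) (\prod_(d <- c :: s) w d)%:E)%E.
  by rewrite esum_esum // => c s _ _; rewrite lee_fin.
rewrite -esumZl //; apply: eq_esum => c _.
rewrite muleC -hB -esumZl //.
by apply: eq_esum => s _; rewrite big_cons EFinM.
Qed.

(** Independent trees, each marked dead or with a survivor by [h]: the survivors,
    in order, occupy [size es] of the [n] places and the dead trees the others. *)
Lemma esum_forest (T : choiceType) (U : eqType) (w : T -> R) (h : T -> option U)
  (L : R) (F : U -> R) (n : nat) (es : seq U) :
  (forall c, 0 <= w c) ->
  (\esum_(c in [set c | h c = None]) (w c)%:E = L%:E)%E ->
  (forall e, (\esum_(c in [set c | h c = Some e]) (w c)%:E = (F e)%:E)%E) ->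
  (\esum_(s in [set s | size s = n /\ pmap h s = es]) (\prod_(c <- s) w c)%:E
   = ('C(n, size es)%:R * L ^+ (n - size es) * \prod_(e <- es) F e)%:E)%E.
Proof.
move=> w0 hL hF; elim: n es => [|n IH] es.
  case: es => [|e es] /=.
    rewrite (_ : [set _ | _] = [set [::]]) ?esum_set1 ?big_nil ?lee_fin //.
      by rewrite bin0 expr0 !mulr1.
    by apply/seteqP; split=> [s [/size0nil]|s ->].
  rewrite (_ : [set _ | _] = set0) ?esum_set0 ?bin_small ?mul0r //.
  by apply/seteqP; split=> [s [/size0nil ->]|s].
pose J es := [set s | size s = n /\ pmap h s = es].
pose dead := [set s : seq T | pmap h (take 1 s) = [::]].
have deadE : [set s | size s = n.+1 /\ pmap h s = es] `&` dead =
    [set c :: s | c in [set c | h c = None] & s in J es].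
  apply/seteqP; split=> [[|c s] [[//= [sz]]]|_ [c hc [s [sz ps] <-]]] /=.
    by rewrite /dead /= take0; case hc: (h c) => [d|] //= ps _; exists c => //; exists s.
  by rewrite /dead /= take0 hc /= sz.
rewrite (esumID dead); last by move=> s _; rewrite lee_fin prodr_ge0.
rewrite deadE (esum_seq_cons _ w0 (IH es)) hL.
case: es {deadE} => [|e es].
  rewrite (_ : _ `&` _ = set0) ?esum_set0 ?adde0; last first.
    apply/seteqP; split=> // -[|c s] [[//= [sz]]].
    by rewrite /dead /= take0; case: (h c).
  by rewrite !bin0 !subn0 big_nil exprS -EFinM; congr (_%:E); ring.
rewrite (_ : _ `&` _ = [set c :: s | c in [set c | h c = Some e] & s in J es]); last first.
  apply/seteqP; split=> [[|c s] [[//= [sz]]]|_ [c hc [s [sz ps] <-]]] /=.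
    rewrite /dead /= take0; case hc: (h c) => [d|] //= [de ps] _.
    by exists c; rewrite /= ?hc ?de //; exists s.
  by rewrite /dead /= take0 hc /= sz ps.
rewrite (esum_seq_cons _ w0 (IH es)) hF -!EFinM -EFinD big_cons; congr (_%:E).
(* Pascal's rule, according to the fate of the first tree; for [n <= size es]
   the truncated exponent is harmless, its binomial factor being zero. *)
rewrite /= subSS binS natrD; have [nm|mn] := ltnP n (size es).+1.
  by rewrite bin_small // !mul0r !add0r; ring.
by rewrite -[in L ^+ (n - size es)](subnSK mn) exprS; ring.
Qed.

End Esum.

(** * Total mass of a critical Galton-Watson tree *)

Definition weight (R : realType) (q : nat -> R) (t : rtree) : R :=
  \prod_(k <- offspring t) q k.

Lemma weight_node (R : realType) (q : nat -> R) cs :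
  weight q (Node cs) = q (size cs) * \prod_(c <- cs) weight q c.
Proof. by rewrite /weight /= big_cons big_flatten /= big_map. Qed.

Lemma weight_ge0 (R : realType) (q : nat -> R) t :
  (forall k, 0 <= q k) -> 0 <= weight q t.
Proof. by move=> q0; apply: prodr_ge0. Qed.

Section TreeSum.
Variables (R : realType) (q : nat -> R).
Hypothesis q0 : forall k, 0 <= q k.
Local Notation w := (weight q).

Lemma esum_node (P : set rtree) :
  (\esum_(t in P) (w t)%:E = \esum_(cs in [set cs | P (Node cs)])
     (q (size cs) * \prod_(c <- cs) w c)%:E)%E.
Proof.
rewrite (reindex_esum [set cs | P (Node cs)] _ Node).
  by apply: eq_esum => cs _; rewrite weight_node.
by split=> [//|cs ds _ _ [//]|[cs] Pcs]; exists cs.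
Qed.

(** [esum_forest] averaged over the number of children of a root. *)
Lemma esum_survivors (U : eqType) (h : rtree -> option U) (L : R) (F : U -> R)
    (S : R) (es : seq U) :
  (\esum_(c in [set c | h c = None]) (w c)%:E = L%:E)%E ->
  (forall e, (\esum_(c in [set c | h c = Some e]) (w c)%:E = (F e)%:E)%E) ->
  sums (fun n => q n * ('C(n, size es)%:R * L ^+ (n - size es))) S ->
  (\esum_(cs in [set cs | pmap h cs = es]) (q (size cs) * \prod_(c <- cs) w c)%:E
   = (S * \prod_(e <- es) F e)%:E)%E.
Proof.
move=> hL hF hS.
pose J n := [set cs | size cs = n /\ pmap h cs = es].
have -> : [set cs | pmap h cs = es] = \bigcup_n J n.
  by apply/seteqP; split=> [cs h1|cs [n _ []//]]; exists (size cs).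
rewrite nneseries_sum_bigcup //; first last.
- by move=> cs; rewrite lee_fin mulr_ge0 // prodr_ge0 // => c _; exact: weight_ge0.
- by apply/trivIsetP => m n _ _ mn; apply/seteqP; split=> // cs [[e1 _] [e2 _]]; rewrite -e1 -e2 eqxx in mn.
rewrite mulrC -(sums_nneseries (sumsZ (\prod_(e <- es) F e) hS)).
apply: eq_eseriesr => n _.
rewrite (eq_esum (b := fun cs => ((q n)%:E * (\prod_(c <- cs) w c)%:E)%E)); last by move=> cs [-> _].
rewrite esumZl //; last by move=> cs; rewrite lee_fin prodr_ge0 // => c _; exact: weight_ge0.
rewrite (esum_forest n es _ hL hF) -?EFinM; last by move=> c; exact: weight_ge0.
by congr (_%:E); ring.
Qed.
End TreeSum.

Section TotalMass.
Variables (R : realType) (q : nat -> R).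
Hypothesis hq : critical_offspring q.
Let q0 := co_ge0 hq.
Local Notation w := (weight q).
Let w0 t : 0 <= w t. Proof. exact: weight_ge0. Qed.

(** The total mass of all trees is a fixed point of [Q] only once it is known to be
    finite; trees of bounded size have children of smaller size, so their mass
    stays at most [Q(1) = 1] by induction. *)
Lemma small_tree_mass_le1 n :
  (\esum_(t in [set t | size (offspring t) <= n]%N) (w t)%:E <= 1)%E.
Proof.
elim: n => [|n IH].
  rewrite (_ : [set _ | _] = set0) ?esum_set0 //.
  by apply/seteqP; split=> // -[cs].
have [L hL] : exists L, (\esum_(t in [set t | size (offspring t) <= n]%N) (w t)%:E = L%:E)%E.
  exists (fine (\esum_(t in [set t | size (offspring t) <= n]%N) (w t)%:E)%E).
  rewrite fineK // ge0_fin_numE ?(le_lt_trans IH) ?ltry //.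
  by apply: esum_ge0 => t _; rewrite lee_fin.
have L0 : 0 <= L by rewrite -lee_fin -hL; apply: esum_ge0 => t _; rewrite lee_fin.
have L1 : L <= 1 by rewrite -lee_fin -hL.
pose h t := if (size (offspring t) <= n)%N then None else Some t.
have hN : (\esum_(c in [set c | h c = None]) (w c)%:E = L%:E)%E.
  rewrite -hL; congr esum; apply/seteqP; split=> t; rewrite /h /=; first by case: ifP.
  by move=> ->.
have hS e : (\esum_(c in [set c | h c = Some e]) (w c)%:E = (if (size (offspring e) <= n)%N then 0 else w e)%:E)%E.
  case: ifPn => he.
    rewrite (_ : [set _ | _] = set0) ?esum_set0 //; apply/seteqP; split=> // t.
    by rewrite /h /=; case: ifPn => // ht [te]; rewrite te he in ht.
  rewrite (_ : [set _ | _] = [set e]) ?esum_set1 ?lee_fin //; apply/seteqP; split=> t.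
    by rewrite /h /=; case: ifPn => // _ [].
  by move=> ->; rewrite /h /= (negbTE he).
have dom k : 0 <= q k * ('C(k, 0)%:R * L ^+ (k - 0)) <= q k.
  rewrite bin0 mul1r mulr_ge0 ?exprn_ge0 //= -[leRHS]mulr1 ler_wpM2l //.
  exact: exprn_ile1.
have S := sums_dominated dom (co_sum hq).
apply: (@le_trans _ _ (\esum_(cs in [set cs | pmap h cs = [::]]) (q (size cs) * \prod_(c <- cs) w c)%:E)%E).
  rewrite esum_node //; apply: esum_subset => cs /= hcs.
  have: all (fun c => size (offspring c) <= n)%N cs.
    apply/allP => c c_cs; move: hcs; rewrite ltnS; apply: leq_trans.
    elim: cs c_cs => //= d cs IHcs; rewrite inE size_cat => /predU1P[->|/IHcs le_c].
      exact: leq_addr.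
    exact: leq_trans le_c (leq_addl _ _).
  by elim: cs {hcs} => //= c cs IHcs /andP[hc hcs]; rewrite /h hc /= -/h IHcs.
rewrite (esum_survivors q0 hN hS (es := [::]) S) big_nil mulr1 lee_fin.
by apply: (sums_le _ S (co_sum hq)) => k; case/andP: (dom k).
Qed.

(** The mass [M] satisfies [Q(M) = M], and [Q] lies strictly above the diagonal
    on [[0, 1)]. *)
Lemma tree_mass1 : (\esum_(t in [set: rtree]) (w t)%:E = 1)%E.
Proof.
have le1 : (\esum_(t in [set: rtree]) (w t)%:E <= 1)%E.
  apply: ge_ereal_sup => _ [A [finA _] <-].
  pose n := \max_(t <- fset_set A) size (offspring t).
  apply: le_trans (small_tree_mass_le1 n); apply: ereal_sup_ubound; exists A => //.
  split=> // t At /=; apply: (@leq_bigmax_seq _ _ xpredT (fun t => size (offspring t))) => //.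
  by rewrite in_fset_set //; exact: mem_set.
have [M hM] : exists M, (\esum_(t in [set: rtree]) (w t)%:E = M%:E)%E.
  exists (fine (\esum_(t in [set: rtree]) (w t)%:E)%E).
  rewrite fineK // ge0_fin_numE ?(le_lt_trans le1) ?ltry //.
  by apply: esum_ge0 => t _; rewrite lee_fin.
have M0 : 0 <= M by rewrite -lee_fin -hM; apply: esum_ge0 => t _; rewrite lee_fin.
have M1 : M <= 1 by rewrite -lee_fin -hM.
rewrite hM; congr (_%:E); apply/eqP; rewrite eq_le M1 leNgt; apply/negP => lt1.
have M01 : 0 <= M < 1 by rewrite M0.
have := taylor0_gt hq M01; apply/negP; rewrite -leNgt le_eqVlt; apply/orP; left; apply/eqP.
apply: EFin_inj; rewrite -hM esum_node //.
pose h (t : rtree) : option rtree := None.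
have hN : (\esum_(c in [set c | h c = None]) (w c)%:E = M%:E)%E.
  by rewrite -hM; congr esum; apply/seteqP; split.
have hS e : (\esum_(c in [set c | h c = Some e]) (w c)%:E = 0%:E)%E.
  by rewrite (_ : [set _ | _] = set0) ?esum_set0 //; apply/seteqP; split.
transitivity (taylor q M 0 * \prod_(e <- [::] : seq rtree) 0)%:E.
  by rewrite big_nil mulr1.
rewrite -(esum_survivors q0 hN hS (es := [::]) (sums_taylor hq 0 M01)); congr esum.
by apply/seteqP; split=> cs //= _; elim: cs.
Qed.

End TotalMass.

(** * Trees with a given pruning *)

(** What remains of a child of the root: nothing if it is a leaf, and otherwise
    its pruning as a non-root vertex. *)
Definition prune_child (c : rtree) : option rtree :=
  if is_leaf c then None else Some (Defs.contract (Defs.cut c)).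

Lemma prune_child_node cs : prune_child (Node cs) =
  if nilp cs then None
  else Some (if pmap prune_child cs is [:: e] then e else Node (pmap prune_child cs)).
Proof.
rewrite /prune_child /is_leaf /=; case: ifP => // _; congr Some.
suff -> : map Defs.contract (pmap (fun c => if is_leaf c then None else Some (Defs.cut c)) cs)
   = pmap prune_child cs by [].
by elim: cs => //= c cs <-; rewrite /prune_child; case: ifP.
Qed.

Section PrunedWeight.
Variables (R : realType) (q : nat -> R).
Hypothesis hq : critical_offspring q.
Let q0 := co_ge0 hq.
Local Notation w := (weight q).
Local Notation p := (q 0%N).
Local Notation fibre s := [set c | prune_child c = Some s].
Let w0 t : 0 <= w t. Proof. exact: weight_ge0. Qed.
Let F s : R := fine (\esum_(c in fibre s) (w c)%:E)%E.

Let FE s : (\esum_(c in fibre s) (w c)%:E = (F s)%:E)%E.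
Proof.
rewrite /F fineK // ge0_fin_numE; last by apply: esum_ge0 => t _; rewrite lee_fin.
apply: (@le_lt_trans _ _ 1%E); last exact: ltry.
by rewrite -(tree_mass1 hq); exact: esum_subset.
Qed.

Let leafE : (\esum_(c in [set c | prune_child c = None]) (w c)%:E = p%:E)%E.
Proof.
rewrite (_ : [set _ | _] = [set Node [::]]).
  by rewrite esum_set1 ?lee_fin // weight_node big_nil mulr1.
apply/seteqP; split=> [[[|c cs]] //|c ->] //.
Qed.

Let p01 : 0 <= p < 1.
Proof. by have /andP[h ->] := critical_leaf_ge_half hq; rewrite andbT; lra. Qed.

Let forestE es : (\esum_(cs in [set cs | pmap prune_child cs = es])
     (q (size cs) * \prod_(c <- cs) w c)%:E = (taylor q p (size es) * \prod_(e <- es) F e)%:E)%E.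
Proof. exact: (esum_survivors q0 leafE FE (es := es) (sums_taylor hq (size es) p01)). Qed.

Let term_ge0 cs : (0 <= (q (size cs) * \prod_(c <- cs) w c)%:E)%E.
Proof. by rewrite lee_fin mulr_ge0 // prodr_ge0. Qed.

(** A tree is pruned to [Node es] either because its root keeps a single child,
    itself pruned to [Node es], and is then contracted, or because the survivors
    are exactly [es], with [size es <> 1].  For [es] empty the tree reduced to a
    leaf has to be taken away, since it is removed rather than pruned to a leaf. *)
Let fibre_node es : F (Node es) = taylor q p 1 * F (Node es)
  + (if size es == 1 then 0
     else taylor q p (size es) * \prod_(e <- es) F e - (size es == 0)%:R * p).
Proof.
apply: EFin_inj; rewrite -FE esum_node.
rewrite (esumID [set cs | pmap prune_child cs = [:: Node es]]) //; rewrite EFinD; congr (_ + _)%E.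
  rewrite (_ : _ `&` _ = [set cs | pmap prune_child cs = [:: Node es]]).
    by rewrite forestE big_seq1.
  apply/seteqP; split=> [cs []//|cs /= E]; split=> //=.
  by rewrite prune_child_node E; case: cs E.
have setE : [set cs | fibre (Node es) (Node cs)] `&` ~` [set cs | pmap prune_child cs = [:: Node es]]
  = [set cs | [/\ cs <> [::], size es <> 1%N & pmap prune_child cs = es]].
  apply/seteqP; split=> cs /=.
    rewrite prune_child_node; case: nilP => [_ []//|nil].
    move: (pmap prune_child cs) => ds [[]].
    case: ds => [|d [|d' ds]]; [move=> [<-] h|move=> -> h|move=> [<-] h] => //.
  move=> [nil size1 E]; rewrite prune_child_node E.
  split; last by move=> ee; apply: size1; rewrite ee.
  by case: nilP nil => // _ _; case: es size1 {E} => // e [].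
rewrite setE; case: es {setE} => [|e es] /=; last first.
  case: es => [|e' es] /=.
    rewrite (_ : [set _ | _] = set0) ?esum_set0 //.
    by apply/seteqP; split=> // cs [_ ].
  rewrite mul0r subr0 -(forestE [:: e, e' & es]); congr esum; apply/seteqP; split=> cs [] //= E.
  by split=> // z; rewrite z in E.
rewrite mul1r EFinB -(forestE [::]) (esumID [set [::]]) //.
rewrite (_ : _ `&` [set [::]] = [set [::]]); last first.
  by apply/seteqP; split=> [cs []//|cs -> //].
rewrite esum_set1 // big_nil mulr1 [X in (X - _)%E]addeC addeK //; congr esum.
by apply/seteqP; split=> cs /=; [case|case=> ? ?; split].
Qed.

(** The equation [fibre_node] is linear in the weight of the fibre of [Node es],
    with coefficient [Q'(q_0) < 1]; solving it, by induction on the tree, produces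
    the law [pruned q (q 0)]. *)
Lemma pruned_weight s : (\esum_(c in fibre s) (w c)%:E
   = ((1 - p) * weight (pruned q p) s)%:E)%E.
Proof.
rewrite FE; congr (_%:E).
elim/rtree_ind_in: s => es IH.
have np : 1 - p != 0 by rewrite gt_eqF // subr_gt0; case/andP: p01.
have t1 : 1 - taylor q p 1 != 0 by rewrite gt_eqF // subr_gt0 taylor1_lt1.
have prodF : \prod_(e <- es) F e = (1 - p) ^+ size es * \prod_(e <- es) weight (pruned q p) e.
  elim: es IH => [|e es IHes] IH; first by rewrite !big_nil mulr1.
  rewrite !big_cons (IH e (mem_head _ _)) IHes; first by rewrite exprS; ring.
  by move=> c c_es; apply: IH; rewrite inE c_es orbT.
rewrite weight_node; apply: (mulfI t1).
have -> : (1 - taylor q p 1) * F (Node es) = F (Node es) - taylor q p 1 * F (Node es) by ring.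
rewrite {1}fibre_node addrC addKr /pruned.
case: ifPn => // n1; first by rewrite mul0r !mulr0.
rewrite prodF; case: es {IH prodF n1} => [|e es] /=.
  by rewrite big_nil mul1r expr0 !mulr1; field; rewrite t1 np.
by rewrite mul0r !subr0; field; rewrite t1 np.
Qed.

End PrunedWeight.

(** * Pruning of a Galton-Watson measure *)

(** A planted tree other than the root alone is determined by the subtree hanging
    from its root. *)
Definition stems (B : set ordered_tree) : set rtree :=
  [set t | exists2 o, B o & val o = Node [:: t]].

Lemma gw_weight_stem (R : realType) (q : nat -> R) (o : ordered_tree) t :
  val o = Node [:: t] -> gw_weight q o = weight q t.
Proof. by move=> E; rewrite /gw_weight /nonroot_offspring E /= cats0. Qed.

Lemma ordered_GW_stems (R : realType) (q : nat -> R) (B : set ordered_tree) :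
  (forall k, 0 <= q k) ->
  (ordered_GW q B = \esum_(t in stems B) (weight q t)%:E)%E.
Proof.
move=> q0; rewrite /ordered_GW.
rewrite (esumID [set o | size (children (val o)) = 1%N]); last first.
  by move=> o _; rewrite lee_fin /gw_weight; case: ifP => // _; apply: prodr_ge0.
rewrite [X in (_ + X)%E]esum1 ?adde0; last first.
  by move=> o [_ /=]; rewrite /gw_weight; case: eqP.
have childE o : [set o | size (children (val o)) = 1%N] o ->
    val o = Node [:: head (Node [::]) (children (val o))].
  by move=> /=; case: (val o) => -[|c [|]].
rewrite (reindex_esum (B `&` [set o | size (children (val o)) = 1%N]) (stems B)
  (fun o => head (Node [::]) (children (val o)))).
  by apply: eq_esum => o [_ /childE E]; rewrite (gw_weight_stem q E).
split.
- by move=> o [Bo /childE E]; exists o.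
- move=> o o' /set_mem[_ /childE E] /set_mem[_ /childE E'] ee.
  by apply: val_inj; rewrite E E' ee.
- move=> t [ot Bo E]; exists ot; last by rewrite /= E.
  by split=> //=; rewrite E.
Qed.

Lemma val_ordered_prune (o : ordered_tree) t : val o = Node [:: t] ->
  val (ordered_prune o) = if prune_child t is Some s then Node [:: s] else Node [::].
Proof.
move=> E; rewrite /= /prune_rtree E /prune_child /series_reduction /=.
by case: ifP.
Qed.

Lemma mem1_weight (R : realType) (q : nat -> R) t :
  q 1%N = 0 -> 1%N \in offspring t -> weight q t = 0.
Proof.
move=> q1 h; rewrite /weight; apply/eqP; rewrite prodf_seq_eq0.
by apply/hasP; exists 1%N => //; rewrite q1 eqxx.
Qed.

Lemma reduced_stem t : planted (Node [:: t]) && reduced (Node [:: t]) = (1%N \notin offspring t).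
Proof. by rewrite /planted /reduced /nonroot_offspring /= cats0. Qed.

Lemma stems_reduced B t : stems B t -> 1%N \notin offspring t.
Proof. by move=> [ot _ E]; rewrite -reduced_stem -E; case: ot {E}. Qed.

Section PruneGW.
Local Open Scope quotient_scope.
Variables (R : realType) (q : nat -> R).
Hypothesis hq : critical_offspring q.
Let q0 := co_ge0 hq.
Local Notation w := (weight q).
Local Notation p := (q 0%N).
Local Notation q' := (pruned q p).
Let p01 : 0 <= p < 1.
Proof. by have /andP[h ->] := critical_leaf_ge_half hq; rewrite andbT; lra. Qed.
Let hq' : critical_offspring q'. Proof. exact: pruned_critical. Qed.
Let q'0 := co_ge0 hq'.

(** Trees with a vertex having a single child are not reduced; they occur among
    the trees pruned to a given one, but carry no weight as [q_1 = 0]. *)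
Lemma ordered_GW_prune (B : set ordered_tree) :
  (ordered_GW q [set o | B (ordered_prune o) /\ ordered_prune o <> ordered_phi]
   = (1 - p)%:E * ordered_GW q' B)%E.
Proof.
rewrite !ordered_GW_stems // -esumZl; first last.
- by move=> t; rewrite lee_fin weight_ge0.
- by rewrite subr_ge0 ltW //; case/andP: p01.
under [RHS]eq_esum do rewrite -EFinM -pruned_weight //.
rewrite esum_esum; last by move=> s t _ _; rewrite lee_fin weight_ge0.
transitivity (\esum_(t in [set t | exists2 s, stems B s & prune_child t = Some s]) (w t)%:E)%E; last first.
  apply: (reindex_esum _ _ snd); split.
  - by move=> [s t] [/= Bs h]; exists s.
  - move=> [s t] [s' t'] /set_mem[_ /= h] /set_mem[_ /= h'] /= e.
    by move: h; rewrite e h' => -[->].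
  - by move=> t [s Bs h]; exists (s, t).
rewrite [RHS](esumID [set t | 1%N \notin offspring t]); last first.
  by move=> t _; rewrite lee_fin weight_ge0.
rewrite [X in (_ + X)%E]esum1 ?adde0; last first.
  by move=> t [_ /negP]; rewrite negbK => h; rewrite (mem1_weight (co_1 hq) h).
congr esum; apply/seteqP; split=> t /=.
  move=> h; split; last exact: stems_reduced h.
  case: h => o [Bo nphi] E.
  have := val_ordered_prune E; case: (prune_child t) => [s|] Eo.
    by exists s => //; exists (ordered_prune o).
  by case: nphi; apply: val_inj.
move=> [[s [ot' Bo' E'] h] red].
have P : planted (Node [:: t]) && reduced (Node [:: t]) by rewrite reduced_stem.
exists (OrderedTree P) => //=.
have := @val_ordered_prune (OrderedTree P) t erefl; rewrite h => Eo.
have oo : ordered_prune (OrderedTree P) = ot' by apply: val_inj; rewrite Eo E'.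
by rewrite oo; split=> // o'phi; rewrite o'phi in E'.
Qed.

Lemma pi_eq_phi (o : ordered_tree) : \pi_tree o = phi <-> o = ordered_phi.
Proof.
split=> [/eqmodP h|->//]; apply: val_inj.
have : iso (val o) (Node [::]) := h.
by move=> /is_leaf_iso; rewrite /is_leaf; case: (val o) => -[|c cs].
Qed.

Lemma GW_setT : (GW q setT = 1)%E.
Proof.
rewrite /GW /pushforward preimage_setT ordered_GW_stems // -(tree_mass1 hq).
rewrite [RHS](esumID [set t | 1%N \notin offspring t]); last first.
  by move=> t _; rewrite lee_fin weight_ge0.
rewrite [X in (_ + X)%E]esum1 ?adde0; last first.
  by move=> t [_ /negP]; rewrite negbK => h; rewrite (mem1_weight (co_1 hq) h).
congr esum; apply/seteqP; split=> t /=; first by move=> h; split=> //; exact: stems_reduced h.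
move=> [_ red]; have P : planted (Node [:: t]) && reduced (Node [:: t]) by rewrite reduced_stem.
by exists (OrderedTree P).
Qed.

End PruneGW.

Lemma conditional_prune_GW (R : realType) (q : nat -> R) : critical_offspring q ->
  conditional (pushforward (GW q) prune) [set T | T <> phi] = GW (pruned q (q 0%N)).
Proof.
move=> hq; have /andP[h p1] := critical_leaf_ge_half hq.
have p01 : 0 <= q 0%N < 1 by rewrite p1 andbT; lra.
have hq' := pruned_critical hq p01.
have E A : (pushforward (GW q) prune (A `&` [set T | T <> phi])
    = (1 - q 0%N)%:E * GW (pruned q (q 0%N)) A)%E.
  rewrite /GW /pushforward -ordered_GW_prune //; congr ordered_GW.
  apply/seteqP; split=> o /=; rewrite -pi_prune.
    by move=> [Ao nphi]; split=> // e; apply: nphi; apply/pi_eq_phi.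
  by move=> [Ao nphi]; split=> // /pi_eq_phi.
apply/funext => A; rewrite /conditional E -[X in (_ / pushforward _ _ X)%E]setTI E GW_setT //.
have [a ->] : exists a, GW (pruned q (q 0%N)) A = a%:E.
  exists (fine (GW (pruned q (q 0%N)) A)); rewrite fineK // ge0_fin_numE.
    apply: (@le_lt_trans _ _ 1%E); last exact: ltry.
    by rewrite -(GW_setT hq') /GW /pushforward; exact: esum_subset.
  apply: esum_ge0 => t _; rewrite lee_fin /gw_weight; case: ifP => // _.
  by apply: prodr_ge0 => k _; exact: co_ge0 hq' k.
have np : 1 - q 0%N != 0 by rewrite gt_eqF // subr_gt0.
by rewrite mule1 inver (negbTE np) -!EFinM mulrC mulKf.
Qed.

(** * The leaf probability under finite variance *)

(** The lower bound [1 / 2] on the leaf probability is automatic, so only the upper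
    bound is recorded. *)
Definition leaf_tends_to_half (R : realType) (q : nat -> R) : Prop :=
  forall e : R, 0 < e -> exists2 d : R, 0 < d &
    forall p, 0 <= p < 1 -> 1 - p < d -> pruned q p 0 <= 1 / 2 + e.

Section PowerBounds.
Variables (R : realFieldType) (p : R).
Hypothesis p01 : 0 <= p <= 1.
Let p0 : 0 <= p. Proof. by case/andP: p01. Qed.
Let p1 : p <= 1. Proof. by case/andP: p01. Qed.
Let u0 : 0 <= 1 - p. Proof. by rewrite subr_ge0. Qed.

Lemma defect_le_square k :
  2 * (p ^+ k - 1 + k%:R * (1 - p)) <= k%:R ^+ 2 * (1 - p) ^+ 2.
Proof.
elim: k => [|k IH]; first by rewrite expr0 subrr !mul0r addr0 mulr0 expr0n mul0r.
have := bernoulli k p01; rewrite exprS -natr1 => B.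
have : (1 - p) * (1 - p ^+ k) <= (1 - p) * (k%:R * (1 - p)).
  by rewrite ler_wpM2l //; lra.
have : 0 <= (1 - p) ^+ 2 by exact: sqr_ge0.
move: (p ^+ k) IH {B} => x IH A B.
lra.
Qed.

(** [2 phi - u phi'] for [phi = (1 - u) ^ k - 1 + k u] vanishes to third
    order at [u = 0]. *)
Lemma defect_le_cube k :
  2 * (p ^+ k - 1 + k%:R * (1 - p)) - (1 - p) * (k%:R * (1 - p ^+ (k - 1)))
  <= k%:R ^+ 3 * (1 - p) ^+ 3.
Proof.
elim: k => [|k IH]; first by rewrite expr0 [0 ^+ 3]exprS !mul0r; lra.
case: k IH => [|k] IH; first by rewrite expr0 expr1 !mul1r; have := exprn_ge0 3 u0; lra.
have b := bernoulli k p01; move: IH; rewrite !subSS !subn0 !exprS -!natr1.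
have pk0 : 0 <= p ^+ k by rewrite exprn_ge0.
move: b pk0; move: (p ^+ k) => x b pk0 IH.
have n0 : 0 <= k%:R :> R by [].
move: (k%:R : R) n0 b IH => n n0 b IH.
have A : n * (1 - p) * (1 - x) <= n * (1 - p) * (n * (1 - p)).
  by rewrite ler_wpM2l ?mulr_ge0 //; lra.
have B : (1 - p) * ((1 - x) - n * (1 - p) * x) <= (1 - p) * (n ^+ 2 * (1 - p) ^+ 2).
  by rewrite ler_wpM2l //; move: A; rewrite !mulrBr !mulr1 => A; lra.
have C : 0 <= (1 - p) ^+ 3 by rewrite exprn_ge0.
have D : 0 <= (2 * n ^+ 2 + 9 * n + 7) * (1 - p) ^+ 3.
  by rewrite mulr_ge0 // !addr_ge0 ?mulr_ge0 ?sqr_ge0.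
move: IH B D; lra.
Qed.

End PowerBounds.

Section Defect.
Variables (R : realType) (q : nat -> R).
Hypothesis hq : critical_offspring q.
Let q0 := co_ge0 hq.

Lemma sums_defect (p : R) : 0 <= p < 1 ->
  sums (fun k => q k * (p ^+ k - 1 + k%:R * (1 - p))) (taylor q p 0 - p).
Proof.
move=> p01; rewrite (_ : taylor q p 0 - p = taylor q p 0 - 1 + (1 - p) * 1); last by ring.
have := sumsD (sumsB (sums_taylor hq 0 p01) (co_sum hq)) (sumsZ (1 - p) (co_mean hq)).
by apply: eq_sums => k; rewrite bin0 subn0; ring.
Qed.

Lemma sums_slope (p : R) : 0 <= p < 1 ->
  sums (fun k => q k * ((1 - p) * (k%:R * (1 - p ^+ (k - 1)))))
       ((1 - p) * (1 - taylor q p 1)).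
Proof.
move=> p01; have := sumsZ (1 - p) (sumsB (co_mean hq) (sums_taylor hq 1 p01)).
by apply: eq_sums => k; rewrite bin1; ring.
Qed.

Lemma sums_tail (v : nat -> R) V N : sums v V ->
  sums (fun k => if (k < N)%N then 0 else v k) (V - series v N).
Proof.
move=> hv; have f : sums (fun k => if (k < N)%N then v k else 0) (series v N).
  case: N => [|N].
    rewrite /series /= big_geq //; apply: eq_sums (sums_delta 0 0) => k.
    by rewrite mulr0.
  rewrite (_ : series v N.+1 = \sum_(n < N.+1) (if (n < N.+1)%N then v n else 0)).
    by apply: sums_finite => n nN; rewrite ltnS leqNgt nN.
  by rewrite /series /= big_mkord; apply: eq_bigr => i _; rewrite ltn_ord.
apply: eq_sums (sumsB hv f) => k; case: ifP => _; first by rewrite subrr.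
by rewrite subr0.
Qed.

(** In the sum for [2 g - u g'] the terms [k < N] are at most [N k^2 q_k u^3] and
    the others at most [k^2 q_k u^2], with small total for large [N]. *)
Lemma finite_variance_leaf_tends_to_half V :
  sums (fun k => k%:R ^+ 2 * q k) V -> leaf_tends_to_half q.
Proof.
move=> hV e e0; have [c c0 hc] := taylor1_lt1_linear hq.
have V0 : 0 <= V by apply: sums_ge0 hV => k; rewrite mulr_ge0 ?sqr_ge0.
have ec : 0 < e * c by rewrite mulr_gt0.
have [N hN] : exists N, V - series (fun k => k%:R ^+ 2 * q k) N < e * c.
  have /sumsP/cvgrPdist_lt/(_ _ ec)[N _ /(_ N (leqnn N)) h] := hV.
  by exists N; apply: le_lt_trans h; exact: ler_norm.
set T := V - _ in hN; have NV0 : 0 < N%:R * V + 1 by rewrite ltr_wpDl ?mulr_ge0.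
exists (e * c / (N%:R * V + 1)); first by rewrite divr_gt0.
move=> p p01 pd; have /andP[p0 p1] := p01.
have p01' : 0 <= p <= 1 by rewrite p0 ltW.
have u0 : 0 < 1 - p by rewrite subr_gt0.
have D0 := pruned_den_gt0 hq p01.
rewrite /pruned /= mul1r expr0 mulr1 ler_pdivrMr //.
have key : 2 * (taylor q p 0 - p) - (1 - p) * (1 - taylor q p 1)
           <= N%:R * (1 - p) ^+ 3 * V + (1 - p) ^+ 2 * T.
  have L := sumsB (sumsZ 2 (sums_defect p01)) (sums_slope p01).
  have U := sumsD (sumsZ (N%:R * (1 - p) ^+ 3) hV) (sumsZ ((1 - p) ^+ 2) (sums_tail N hV)).
  apply: (sums_le _ L U) => k.
  have sq := defect_le_square p01' k; have cu := defect_le_cube p01' k.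
  have k0 : 0 <= (1 - p) * (k%:R * (1 - p ^+ (k - 1))).
    by rewrite !mulr_ge0 ?(ltW u0) // subr_ge0 exprn_ile1 // ltW.
  rewrite [leLHS](_ : _ = q k * (2 * (p ^+ k - 1 + k%:R * (1 - p)) - (1 - p) * (k%:R * (1 - p ^+ (k - 1))))); last by ring.
  case: ltnP => kN.
    rewrite [leRHS](_ : _ = q k * (N%:R * k%:R ^+ 2 * (1 - p) ^+ 3)); last by ring.
    rewrite ler_wpM2l //; apply: le_trans cu _; rewrite ler_wpM2r ?exprn_ge0 ?(ltW u0) //.
    by rewrite exprS ler_wpM2r ?sqr_ge0 // ler_nat ltnW.
  rewrite [leRHS](_ : _ = q k * (N%:R * (1 - p) ^+ 3 * k%:R ^+ 2 + k%:R ^+ 2 * (1 - p) ^+ 2)); last by ring.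
  rewrite ler_wpM2l //; apply: le_trans (_ : _ <= k%:R ^+ 2 * (1 - p) ^+ 2) _; first lra.
  by rewrite lerDr !mulr_ge0 ?exprn_ge0 ?(ltW u0).
have u2 : 0 < (1 - p) ^+ 2 by rewrite exprn_gt0.
have B1 : (1 - p) ^+ 2 * ((1 - p) * (N%:R * V + 1)) <= (1 - p) ^+ 2 * (e * c).
  by rewrite ler_pM2l // -ler_pdivlMr // ltW.
have B2 : (1 - p) ^+ 2 * T <= (1 - p) ^+ 2 * (e * c) by rewrite ler_pM2l // ltW.
have B3 : e * ((1 - p) * (c * (1 - p))) <= e * ((1 - p) * (1 - taylor q p 1)).
  by rewrite ler_pM2l // ler_pM2l // hc.
have B4 : 0 < (1 - p) ^+ 3 by rewrite exprn_gt0.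
move: B1 B2 B3 B4 key; lra.
Qed.

End Defect.

(** * The generating function and S *)

Lemma sums_shift (R : realType) (u : nat -> R) s : sums u s ->
  sums (fun n => u n.+1) (s - u 0%N).
Proof.
move=> /sumsP us; apply/sumsP.
rewrite (_ : series _ = (fun n => series u n.+1 - u 0%N)).
  by apply: cvgB; [rewrite -/(fun n => series u n.+1) cvg_shiftS|exact: cvg_cst].
apply/funext => n; rewrite /series /= big_nat_recl // addrC addKr //.
Qed.

Lemma expR_powR (R : realType) (x s : R) : expR x `^ s = expR (s * x).
Proof. by rewrite /powR gt_eqF ?expR_gt0 // expRK. Qed.

Lemma le_powR_of_le_min (R : realType) (z x s : R) : 0 <= z -> 1 <= s <= 2 ->
  x <= z -> x <= z ^+ 2 -> x <= z `^ s.
Proof.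
move=> z0 /andP[s1 s2] xz xz2; have [z1|z1] := leP 1 z.
  exact: le_trans xz (le1r_powR z1 s1).
have [zE|nz] := eqVneq z 0.
  by move: xz; rewrite zE powR0 // gt_eqF // (lt_le_trans _ s1).
apply: le_trans xz2 _; rewrite -powR_mulrn //.
by apply: ger_powR => //; rewrite lt_neqAle eq_sym nz z0 ltW.
Qed.

Section GenFun.
Variables (R : realType) (q : nat -> R).
Hypothesis hq : critical_offspring q.
Let q0 := co_ge0 hq.

Lemma gen_fun_taylor (x : R) : gen_fun q x = taylor q x 0.
Proof.
rewrite /gen_fun /pseries /taylor; congr (limn (series _)); apply/funext => k.
by rewrite bin0 mul1r subn0.
Qed.

Lemma sums_pseries_diffs (x : R) : 0 <= x < 1 ->
  sums (fun k => pseries_diffs q k * x ^+ k) (taylor q x 1).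
Proof.
move=> x01; have := sums_shift (sums_taylor hq 1 x01).
rewrite bin_small // !mul0r mulr0 subr0; apply: eq_sums => k.
by rewrite bin1 subn1 /pseries_diffs /=; ring.
Qed.

Lemma derive_gen_fun (x : R) : 0 <= x < 1 -> derive1 (gen_fun q) x = taylor q x 1.
Proof.
move=> x01; have /andP[x0 x1] := x01; pose K := (1 + x) / 2.
have K01 : 0 <= K < 1 by rewrite /K; lra.
have D : is_derive x (1 : R) (gen_fun q) (limn (pseries (pseries_diffs q) x)).
  apply: (@pseries_snd_diffs _ q K).
  - apply: sums_cvg (eq_sums _ (sums_taylor hq 0 K01)) => k.
    by rewrite bin0 mul1r subn0.
  - exact: sums_cvg (sums_pseries_diffs K01).
  - apply: sums_cvg (eq_sums _ (sumsZ 2 (sums_shift (sums_shift (sums_taylor hq 2 K01))))) => k /=.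
    rewrite /pseries_diffs subSS subSS subn0.
    have := congr1 (fun n => n%:R : R) (mul_bin_diag k.+2 1).
    rewrite bin1 !natrM /= => E.
    transitivity (2 * 'C(k.+2, 2)%:R * (q k.+2 * K ^+ k)); first by ring.
    by rewrite -E; ring.
  - by rewrite !ger0_norm /K; lra.
rewrite derive1E; have [_ ->] := D.
by apply: sums_lim; exact: sums_pseries_diffs.
Qed.

(** [S] is Newton's step for the equation [Q(z) = z], and one pruning moves the
    level [p] by one Newton step. *)
Lemma S_fun_leaf (x : R) : 0 <= x < 1 ->
  (1 - S_fun q x) / (1 - x) = 1 - pruned q x 0.
Proof.
move=> x01; rewrite /S_fun derive_gen_fun // gen_fun_taylor /pruned /= expr0.
have := taylor1_lt1 hq x01; have /andP[_] := x01.
rewrite -subr_gt0 => /gt_eqF/negbT a; rewrite -subr_gt0 => /gt_eqF/negbT b.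
by field; rewrite a b.
Qed.

End GenFun.

(** * The leaf probability under moments of order below two *)

Lemma power_tangent (R : realDomainType) (x y : R) k : 0 <= x -> x <= y ->
  x ^+ k + k%:R * (y - x) * x ^+ (k - 1) <= y ^+ k.
Proof.
move=> x0 xy; elim: k => [|k IH]; first by rewrite !mul0r addr0.
have y0 : 0 <= y by exact: le_trans xy.
rewrite subSS subn0 [leRHS]exprS; apply: le_trans (ler_wpM2l y0 IH).
case: k {IH} => [|k]; first by rewrite !expr0 expr1 !mul0r !mul1r !mulr1; lra.
rewrite subSS subn0 -!natr1 !exprS.
rewrite -subr_ge0 (_ : _ - _ = (k%:R + 1) * (y - x) ^+ 2 * x ^+ k); last by ring.
by rewrite !mulr_ge0 ?subr_ge0 ?exprn_ge0 ?addr_ge0.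
Qed.

Section PowerLaw.
Variables (R : realType) (q : nat -> R).
Hypothesis hq : critical_offspring q.
Let q0 := co_ge0 hq.
Let g (u : R) := taylor q (1 - u) 0 - (1 - u).

Lemma defect_gt0 (u : R) : 0 < u <= 1 -> 0 < g u.
Proof.
by move=> /andP[u0 u1]; rewrite /g subr_gt0; apply: taylor0_gt => //; lra.
Qed.

(** [(1 - u)^k - 1 + k u] is at most [k u] and at most [(k u)^2], hence at most
    [(k u)^s] for [s] between 1 and 2. *)
Lemma defect_le_moment (s C u : R) : 1 <= s <= 2 -> 0 < u <= 1 ->
  sums (fun k => k%:R `^ s * q k) C -> g u <= C * u `^ s.
Proof.
move=> s12 /andP[u0 u1] hC; have p01 : 0 <= 1 - u < 1 by lra.
have p01' : 0 <= 1 - u <= 1 by lra.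
rewrite mulrC; apply: (sums_le _ (sums_defect hq p01) (sumsZ (u `^ s) hC)) => k.
rewrite [leRHS](_ : _ = q k * (k%:R `^ s * u `^ s)); last by ring.
rewrite -powRM ?(ltW u0) // ler_wpM2l //.
rewrite subKr.
have ku : 0 <= k%:R * u by rewrite mulr_ge0 // ltW.
apply: le_powR_of_le_min => //.
  by rewrite gerDr subr_le0 exprn_ile1 //; lra.
have := defect_le_square p01' k; rewrite subKr -exprMn.
by have := sqr_ge0 (k%:R * u); lra.
Qed.

(** The tangent inequality for the convex function [g], at [u] and [th * u]. *)
Lemma defect_convex (u th : R) : 0 < u <= 1 -> 0 < th <= 1 ->
  g u - (1 - th) * (u * (1 - taylor q (1 - u) 1)) <= g (th * u).
Proof.
move=> /andP[u0 u1] /andP[t0 t1].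
have p01 : 0 <= 1 - u < 1 by lra.
have tu : th * u <= u by rewrite -[leRHS]mul1r ler_wpM2r // ltW.
have tu0 : 0 < th * u by rewrite mulr_gt0.
have y01 : 0 <= 1 - th * u < 1 by lra.
have L := sumsB (sums_defect hq p01) (sumsZ (1 - th) (sums_slope hq p01)).
rewrite !subKr in L.
apply: (sums_le _ L (sums_defect hq y01)) => k.
have x0 : 0 <= 1 - u by lra.
have xy : 1 - u <= 1 - th * u by lra.
rewrite -subr_ge0.
rewrite [X in 0 <= X](_ : _ = q k * ((1 - th * u) ^+ k - ((1 - u) ^+ k + k%:R * ((1 - th * u) - (1 - u)) * (1 - u) ^+ (k - 1)))); last by ring.
by rewrite mulr_ge0 // subr_ge0 power_tangent.
Qed.

(** By convexity a contraction of the argument by [th] costs [g] at most the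
    factor [1 - (1 - th) a]; iterating it replaces the integration of
    [g'(v) / g(v) <= a / v]. *)
Lemma defect_contract_ge (a th u : R) n : 0 < u <= 1 -> 0 < th <= 1 ->
  0 <= 1 - (1 - th) * a ->
  (forall v, 0 < v <= u -> v * (1 - taylor q (1 - v) 1) <= a * g v) ->
  (1 - (1 - th) * a) ^+ n * g u <= g (th ^+ n * u).
Proof.
move=> /andP[u0 u1] th01 lam0 slope; have /andP[th0 th1] := th01.
elim: n => [|n IH]; first by rewrite !expr0 !mul1r.
have v0 : 0 < th ^+ n * u by rewrite mulr_gt0 // exprn_gt0.
have vu : th ^+ n * u <= u.
  by rewrite -[leRHS]mul1r ler_wpM2r ?(ltW u0) // exprn_ile1 // ltW.
have v01 : 0 < th ^+ n * u <= 1 by rewrite v0 (le_trans vu).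
rewrite !exprS -!mulrA; apply: le_trans (defect_convex v01 th01).
apply: le_trans (ler_wpM2l lam0 IH) _.
rewrite mulrBl mul1r lerB // -[leRHS]mulrA ler_wpM2l ?subr_ge0 //.
by apply: slope; rewrite v0.
Qed.

(** Since [s > a], the factor [th ^ s] beats the linear factor [1 - (1 - th) a]
    for [th] close enough to 1. *)
Lemma contraction_gap (a s : R) : 0 < a < s ->
  exists th kap : R, [/\ 0 < th <= 1, 1 < kap & kap * th `^ s <= 1 - (1 - th) * a].
Proof.
move=> /andP[a0 as_]; have s0 : 0 < s by exact: lt_trans as_.
have D0 : 0 < 2 * a * s by rewrite !mulr_gt0.
have sa : 0 < s - a by rewrite subr_gt0.
(* The value of [t] makes [(1 - a t) (1 + s t)] exceed 1 by half of its
   first-order term. *)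
pose t := (s - a) / (2 * a * s); pose kap := 1 + t * (s - a) / 2.
have t0 : 0 < t by rewrite divr_gt0.
have tE : t * (2 * a * s) = s - a by rewrite divfK // gt_eqF.
have kapE : (1 - a * t) * (1 + s * t) = kap.
  transitivity (1 + t * (s - a) - t * (t * (2 * a * s)) / 2); first by field.
  by rewrite tE /kap; field.
exists (expR (- t)), kap; split.
- by rewrite expR_gt0 -expR0 ler_expR oppr_le0 ltW.
- by rewrite ltrDl divr_gt0 // mulr_gt0.
apply: (@le_trans _ _ (1 - a * t)).
  have e0 : 0 < expR (s * t) by rewrite expR_gt0.
  have k0 : 0 < kap by rewrite ltr_wpDr // ltW // divr_gt0 // mulr_gt0.
  have st0 : 0 < 1 + s * t by rewrite ltr_wpDr // mulr_ge0 ?ltW.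
  have at0 : 0 < 1 - a * t by rewrite -(pmulr_lgt0 _ st0) kapE.
  rewrite expR_powR mulrN expRN ler_pdivrMr // -kapE.
  by rewrite ler_pM2l // expR_ge1Dx.
have := expR_ge1Dx (- t) => h.
have : (1 - expR (- t)) * a <= t * a by rewrite ler_pM2r //; lra.
by rewrite [t * a]mulrC; lra.
Qed.

Lemma unbounded_geometric (k B : R) : 1 < k -> exists n, B < k ^+ n.
Proof.
move=> k1; have k0 : 0 < k - 1 by rewrite subr_gt0.
exists (Num.bound `|B / (k - 1)|).
set n := Num.bound _.
have : B / (k - 1) < n%:R by apply: le_lt_trans (ler_norm _) (archi_boundP (normr_ge0 _)).
rewrite ltr_pdivrMr // => Bn.
have := @power_tangent R 1 k n ler01 (ltW k1); rewrite !expr1n mulr1.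
by apply: lt_le_trans; lra.
Qed.

(** A law with all moments of order below 2 cannot have [r >= b > 1 / 2] near
    [p = 1]: that would force [g(u) >= const * u ^ (1 / b)] with [1 / b < 2],
    while the moment of order [s], for [1 / b < s < 2], gives
    [g(u) <= C u ^ s]. *)
Lemma moments_leaf_lt (b d : R) : 0 < d -> 1 / 2 < b ->
  (forall s, 1 <= s < 2 -> exists C, sums (fun k => k%:R `^ s * q k) C) ->
  exists p, [/\ 0 <= p < 1, 1 - p < d & pruned q p 0 <= b].
Proof.
move=> d0 b2 mom; apply: contrapT => no.
have large p : 0 <= p < 1 -> 1 - p < d -> b < pruned q p 0.
  by move=> p01 pd; rewrite ltNge; apply/negP => h; apply: no; exists p.
pose u := Num.min (1 / 2) (d / 2).
have u01 : 0 < u <= 1.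
  by rewrite lt_min ge_min; apply/andP; split; [apply/andP; split|apply/orP; left]; lra.
have ud : u < d by rewrite gt_min; apply/orP; right; lra.
have b0 : 0 < b by lra.
have slope v : 0 < v <= u -> v * (1 - taylor q (1 - v) 1) <= b^-1 * g v.
  move=> /andP[v0 vu]; have /andP[_ u1] := u01.
  have p01 : 0 <= 1 - v < 1 by lra.
  have D0 := pruned_den_gt0 hq p01.
  have := large _ p01; rewrite subKr => /(_ (le_lt_trans vu ud)).
  rewrite /pruned /= mul1r expr0 mulr1 ltr_pdivlMr // subKr -/(g v) => h.
  by rewrite [leRHS]mulrC ler_pdivlMr // mulrC ltW.
have a0 : 0 < b^-1 by rewrite invr_gt0.
have a2 : b^-1 < 2 by rewrite -(ltr_pM2r b0) mulVf ?gt_eqF //; lra.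
pose s := (b^-1 + 2) / 2.
have [s1 s2] : 1 <= s /\ s < 2 by rewrite /s; split; lra.
have [C hC] : exists C, sums (fun k => k%:R `^ s * q k) C by apply: mom; rewrite s1.
have [th [kap [th01 kap1 gap]]] : exists th kap : R,
    [/\ 0 < th <= 1, 1 < kap & kap * th `^ s <= 1 - (1 - th) * b^-1].
  by apply: contraction_gap; rewrite a0 /s; lra.
have /andP[th0 th1] := th01; have /andP[u0 u1] := u01.
have ks0 : 0 < kap * th `^ s by rewrite mulr_gt0 ?powR_gt0 // (lt_trans _ kap1).
have gu0 : 0 < g u by exact: defect_gt0.
have C0 : 0 <= C by apply: sums_ge0 hC => k; rewrite mulr_ge0 ?powR_ge0.
have bound n : kap ^+ n <= C * u `^ s / g u.
  have lam0 := le_trans (ltW ks0) gap.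
  have lower := defect_contract_ge n u01 th01 lam0 slope.
  have v0 : 0 < th ^+ n * u by rewrite mulr_gt0 // exprn_gt0.
  have v01 : 0 < th ^+ n * u <= 1.
    by rewrite v0 mulr_ile1 ?exprn_ge0 ?exprn_ile1 // ltW.
  have s12 : 1 <= s <= 2 by rewrite s1 ltW.
  have upper := defect_le_moment s12 v01 hC.
  have sn : (th ^+ n) `^ s = (th `^ s) ^+ n.
    by rewrite -powR_mulrn ?(ltW th0) // powRAC powR_mulrn // powR_ge0.
  have tn0 : 0 < (th `^ s) ^+ n by rewrite exprn_gt0 // powR_gt0.
  rewrite ler_pdivlMr // -(ler_pM2r tn0).
  have -> : kap ^+ n * g u * (th `^ s) ^+ n = (kap * th `^ s) ^+ n * g u.
    by rewrite exprMn; ring.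
  have -> : C * u `^ s * (th `^ s) ^+ n = C * (th ^+ n * u) `^ s.
    by rewrite powRM ?(ltW u0) ?exprn_ge0 ?(ltW th0) // sn; ring.
  apply: le_trans upper; apply: le_trans lower.
  by rewrite ler_pM2r // lerXn2r // nnegrE ltW.
have [n] := unbounded_geometric (C * u `^ s / g u) kap1.
by rewrite ltNge bound.
Qed.

End PowerLaw.

(** * Convergence of the leaf probability *)

Lemma nneseries2_sums (R : realType) (u : nat -> R) : (forall n, 0 <= u n) ->
  (\sum_(2 <= k <oo) (u k)%:E < +oo)%E -> exists s, sums u s.
Proof.
move=> u0 h; exists (limn (series u)); apply: cvg_sums.
apply: nnseries_is_cvg => //.
rewrite (@nneseries_split _ _ 0 2); last by move=> k _; rewrite lee_fin.
by rewrite lte_add_pinfty // sumEFin ltry.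
Qed.

Section LeafLimit.
Variables (R : realType) (q : nat -> R).
Hypothesis hq : critical_offspring q.
Let q0 := co_ge0 hq.

(** In the second case the limit of [r] is [1 - l]; if [l < 1 / 2] then [r] would stay
    above a number larger than [1 / 2], against [moments_leaf_lt]. *)
Lemma leaf_tends_to_half_of_moments :
  (\sum_(2 <= k <oo) (k%:R ^+ 2 * q k)%:E < +oo)%E
  \/
  (exists l : R, (1 - S_fun q x) / (1 - x) @[x --> 1^'-] --> l)
  /\
  (forall e : R, 0 < e ->
    (\sum_(2 <= k <oo) (k%:R `^ (2 - e) * q k)%:E < +oo)%E) ->
  leaf_tends_to_half q.
Proof.
case=> [/nneseries2_sums[k|V]|[[l Sl] mom]].
- by rewrite mulr_ge0 ?sqr_ge0.
- exact: finite_variance_leaf_tends_to_half.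
have near_l e : 0 < e -> exists2 d : R, 0 < d &
    forall p, 0 <= p < 1 -> 1 - p < d -> `|l - (1 - pruned q p 0)| < e.
  move=> e0; have := Sl; move=> /cvgrPdist_lt/(_ e e0).
  rewrite near_withinE => -[d d0 h]; exists d => // p p01 pd.
  have /andP[p0 p1] := p01; rewrite -S_fun_leaf //; apply: h => //=.
  by rewrite ger0_norm ?subr_ge0 // ltW.
have l2 : 1 / 2 <= l.
  rewrite leNgt; apply/negP => l2.
  have e0 : 0 < (1 / 2 - l) / 3 by lra.
  have [d d0 hd] := near_l _ e0.
  have b2 : 1 / 2 < 1 - l - (1 / 2 - l) / 2 by lra.
  have [s s12|p [p01 pd]] := moments_leaf_lt hq d0 b2.
    apply: nneseries2_sums => [k|]; first by rewrite mulr_ge0 ?powR_ge0.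
    have -> : s = 2 - (2 - s) by ring.
    by apply: mom; lra.
  by have := hd p p01 pd; rewrite ltr_norml => /andP[]; lra.
move=> e e0; have [d d0 hd] := near_l e e0; exists d => // p p01 pd.
by have := hd p p01 pd; rewrite ltr_norml => /andP[]; lra.
Qed.

End LeafLimit.

(** * Iterated pruning *)

(** Finiteness matters: the probability of an unlabeled tree is a sum over its
    planar orderings, and its limit is taken term by term. *)
Lemma finite_iso s : finite_set [set t | iso s t].
Proof.
elim/rtree_ind_in: s => cs IH.
have fin : finite_set [set ds | all2 iso cs ds].
  elim: cs IH => [|c cs IHcs] IH.
    by apply: sub_finite_set (finite_set1 [::]) => -[].
  apply: (@sub_finite_set _ _ ((fun z => z.1 :: z.2) @` ([set d | iso c d] `*` [set ds | all2 iso cs ds]))).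
    by move=> [//|d ds] /= /andP[cd cds]; exists (d, ds).
  apply: finite_image; apply: finite_setX; first exact/IH/mem_head.
  by apply: IHcs => e e_cs; apply: IH; rewrite inE e_cs orbT.
apply: (@sub_finite_set _ _ (\bigcup_(ds in [set ds | all2 iso cs ds]) (Node @` [set` permutations ds]))).
  move=> [ds] /isoP[ds' p a]; exists ds' => //=; exists ds => //=.
  by rewrite mem_permutations perm_sym.
apply: bigcup_finite => // ds _; apply: finite_image; exact: finite_seq.
Qed.

Lemma finite_stems_tree (T : tree) : finite_set (stems (\pi_tree%qT @^-1` [set T])).
Proof.
apply: (@sub_finite_set _ _ ((fun t => head (Node [::]) (children t)) @` [set t | iso (val (repr T)) t])).
  move=> t [ot pT E]; exists (Node [:: t]) => //=.
  rewrite -E; have : (\pi_tree (repr T) = \pi_tree ot)%qT by rewrite reprK pT.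
  by move=> /eqmodP.
exact/finite_image/finite_iso.
Qed.

Section Iterates.
Variables (R : realType) (q : nat -> R).
Hypothesis hq : critical_offspring q.

(** The thinning level reached by [k] prunings. *)
Fixpoint level (k : nat) : R :=
  if k is k'.+1 then level k' + (1 - level k') * pruned q (level k') 0 else 0.

Lemma level_bounds k : 0 <= level k < 1 /\ 1 - level k <= 2^-1 ^+ k.
Proof.
elim: k => [|k [p01 IH]]; first by rewrite /= lexx ltr01 subr0 expr0.
have /andP[p0 p1] := p01.
have /andP[r0 r1] := critical_leaf_ge_half (pruned_critical hq p01).
have u0 : 0 < 1 - level k by lra.
have E : 1 - level k.+1 = (1 - level k) * (1 - pruned q (level k) 0) by rewrite /=; ring.
have v0 : 0 < 1 - level k.+1 by rewrite E mulr_gt0 //; lra.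
split; last first.
  rewrite E exprSr ler_pM //; lra.
apply/andP; split; last lra.
by rewrite /= addr_ge0 // mulr_ge0 //; lra.
Qed.

Lemma pruned_level k :
  pruned (pruned q (level k)) (pruned q (level k) 0) = pruned q (level k.+1).
Proof.
have [p01 _] := level_bounds k; rewrite pruned_pruned //.
by have /andP[h ->] := critical_leaf_ge_half (pruned_critical hq p01); rewrite andbT; lra.
Qed.

Hypothesis half : leaf_tends_to_half q.

Lemma cvg_leaf : pruned q (level k) 0 @[k --> \oo] --> (2^-1 : R).
Proof.
apply/cvgrPdist_lt => e e0.
have e20 : 0 < e / 2 by lra.
have [d d0 hd] := half e20.
have c0 : (2^-1 : R) ^+ k @[k --> \oo] --> 0.
  by apply: cvg_expr; rewrite ger0_norm; lra.
near=> k.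
have [p01 pk] := level_bounds k.
have /andP[r0 r1] := critical_leaf_ge_half (pruned_critical hq p01).
have : 1 - level k < d.
  apply: le_lt_trans pk _; near: k.
  move/cvgrPdist_lt : c0 => /(_ d d0); apply: filterS => k.
  by rewrite sub0r normrN ger0_norm // exprn_ge0.
move=> /(hd _ p01) h; rewrite ltr_norml; apply/andP; split; lra.
Unshelve. all: by end_near. Qed.

Definition binary_law (k : nat) : R :=
  if (k == 0)%N || (k == 2)%N then 2^-1 else 0.

Lemma cvg_offspring m : pruned q (level k) m @[k --> \oo] --> binary_law m.
Proof.
have hk k := pruned_critical hq (level_bounds k).1.
have gap : 2 * pruned q (level k) 0 - 1 @[k --> \oo] --> (0 : R).
  rewrite (_ : 0 = 2 * 2^-1 - 1 :> R); last by lra.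
  by apply: cvgB; [apply: cvgM; [exact: cvg_cst|exact: cvg_leaf]|exact: cvg_cst].
case: m => [|[|[|m]]]; rewrite /binary_law /=.
- exact: cvg_leaf.
- by apply: cvg_cst.
- rewrite (_ : 2^-1 = (1 - 2^-1) + 0 :> R); last by lra.
  rewrite (_ : (fun k => _) = fun k => (1 - pruned q (level k) 0) + (pruned q (level k) 2 - (1 - pruned q (level k) 0))); last first.
    by apply/funext => k; ring.
  apply: cvgD; first by apply: cvgB; [exact: cvg_cst|exact: cvg_leaf].
  apply/norm_cvg0P; apply: (squeeze_cvgr _ (cvg_cst 0) gap).
  by near=> k; rewrite normr_ge0 critical_q2.
- apply: (squeeze_cvgr _ (cvg_cst 0) gap); near=> k.
  by rewrite (co_ge0 (hk k)) critical_tail_le.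
Unshelve. all: by end_near. Qed.

Lemma cvg_weight t : weight (pruned q (level k)) t @[k --> \oo] --> weight binary_law t.
Proof.
rewrite /weight; elim: (offspring t) => [|m s IH].
  under eq_fun do rewrite big_nil; rewrite big_nil; exact: cvg_cst.
under eq_fun do rewrite big_cons; rewrite big_cons.
by apply: cvgM => //; exact: cvg_offspring.
Qed.

Lemma cvg_GW T : GW (pruned q (level k)) [set T] @[k --> \oo] --> GW binary_law [set T].
Proof.
have fin := finite_stems_tree T; set S := stems _ in fin.
have GWE (q' : nat -> R) : (forall k, 0 <= q' k) ->
    GW q' [set T] = (\sum_(t <- fset_set S) weight q' t)%:E.
  move=> q'0; rewrite /GW /pushforward ordered_GW_stems // -/S esum_fset //.
    by rewrite fsbig_finite //= sumEFin.
  by move=> t _; rewrite lee_fin weight_ge0.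
rewrite GWE; last by move=> k; rewrite /binary_law; case: ifP; rewrite ?invr_ge0.
under eq_fun => k do rewrite (GWE _ (co_ge0 (pruned_critical hq (level_bounds k).1))).
apply: cvg_EFin; first exact: nearW.
rewrite /comp /=; elim: (enum_fset (fset_set S)) => [|t s IH].
  under eq_fun do rewrite big_nil; rewrite big_nil; exact: cvg_cst.
under eq_fun do rewrite big_cons; rewrite big_cons.
by apply: cvgD => //; exact: cvg_weight.
Qed.

End Iterates.

Theorem corollary5 (R : realType) (q : nat -> R)
    (hq : critical_distribution q) (hq1 : q 1%N = 0)
    (hab :
      (\sum_(2 <= k <oo) (k%:R ^+ 2 * q k)%:E < +oo)%E
      \/
      (exists l : R, (1 - S_fun q x) / (1 - x) @[x --> 1^'-] --> l)
      /\
      (forall e : R, 0 < e ->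
        (\sum_(2 <= k <oo) (k%:R `^ (2 - e) * q k)%:E < +oo)%E))
    (rho nu : nat -> set tree -> \bar R)
    (hrho0 : rho 0%N = GW q)
    (hnu : forall k, nu k = pushforward (rho k) prune)
    (hrho : forall k, rho k.+1 = conditional (nu k) [set T | T <> phi])
    (T : tree) :
  rho k [set T] @[k --> \oo] --> IGW_half R [set T].
Proof.
have cq := critical_distribution_offspring hq hq1.
have half := leaf_tends_to_half_of_moments cq hab.
have rhoE k : rho k = GW (pruned q (level q k)).
  elim: k => [|k IH]; first by rewrite hrho0 /= pruned0.
  rewrite hrho hnu IH conditional_prune_GW; first by rewrite (pruned_level cq).
  by have [p01 _] := level_bounds cq k; exact: pruned_critical.
under eq_fun => k do rewrite rhoE.
exact: cvg_GW.
Qed.
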